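(* Let $D=(\Pi,\mathcal{C})$ be a well-defined domain description over a finite non-empty action alphabet $\Sigma$. There is a one to one correspondence between the extensions of the domain description $D$ and the answer sets of its translation $tr(D)$ in ASP. More precisely, each extension of $D$ is in a one to one correspondence with an answer set of $tr(D)$, and both of them are associated with the same temporal model (that is, if the extension $(\sigma,S)$ corresponds to the answer set $R$, then $M_S=M_R$).
   Context: **Literals and laws.** $\Sigma$ is a finite non-empty set of actions, $\mathcal{P}$ a set of fluent names (atomic propositions). A simple literal is $f$ or $\neg f$ with $f\in\mathcal{P}$. Temporal literals are $[a]l$ (with $a\in\Sigma$) and $\bigcirc l$, with $l$ a simple literal; in heads $l$ may also be $\bot$. ''$not$'' is default negation. A domain description over $\Sigma$ is a pair $D=(\Pi,\mathcal{C})$, where $\mathcal{C}$ is a set of DLTL formulas (defined below) and $\Pi$ is a set of laws (rules) of the following forms, where $l_0$ is a simple literal or $\bot$: - action laws $\Box([a]l_0\leftarrow t_1,\dots,t_m,not\,t_{m+1},\dots,not\,t_n)$, each $t_i$ being a simple literal or of the form $[a]l$ (same $a$); - static causal laws $\Box(l_0\leftarrow l_1,\dots,l_m,not\,l_{m+1},\dots,not\,l_n)$, all $l_i$ ($i\ge1$) simple; - dynamic causal laws $\Box(\bigcirc l_0\leftarrow t_1,\dots,t_m,not\,t_{m+1},\dots,not\,t_n)$, each $t_i$ simple or of the form $\bigcirc l$; - initial state laws $l_0\leftarrow l_1,\dots,l_m,not\,l_{m+1},\dots,not\,l_n$ (no $\Box$), all $l_i$ ($i\ge 1$) simple. It is assumed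 that for each fluent $f$, $\Pi$ contains the initial state laws $f\leftarrow not\,\neg f$ and $\neg f\leftarrow not\,f$. **Temporal answer sets and well-definedness.** Let $\sigma\in\Sigma^\omega$. A partial temporal interpretation over $\sigma$ is a pair $(\sigma,S)$ where $S$ is a set of expressions $[a_1;\dots;a_k]l$ with $a_1\dots a_k$ a finite (possibly empty) prefix of $\sigma$ and $l$ a simple literal, such that $S$ never contains both $[a_1;\dots;a_k]f$ and $[a_1;\dots;a_k]\neg f$, nor $[a_1;\dots;a_k]\bot$. It is total if for every finite prefix $a_1\dots a_k$ of $\sigma$ and every $p\in\mathcal{P}$, $[a_1;\dots;a_k]p\in S$ or $[a_1;\dots;a_k]\neg p\in S$. Satisfaction at a prefix $\tau=a_1\dots a_k$ of $\sigma$: $(\sigma,S),\tau\not\models\bot$; $(\sigma,S),\tau\models l$ iff $[a_1;\dots;a_k]l\in S$ ($l$ simple); $(\sigma,S),\tau\models[a]l$ iff $[a_1;\dots;a_k;a]l\in S$ or $\tau a$ is not a prefix of $\sigma$; $(\sigma,S),\tau\models\bigcirc l$ iff $[a_1;\dots;a_k;b]l\in S$, where $\tau b$ is the prefix of $\sigma$ of length $k+1$; $(\sigma,S),\tau\models not\,t$ iff $(\sigma,S),\tau\not\models t$. A body is satisfied iff all its elements are. A rule $H\leftarrow B$ is satisfied in $(\sigma,S)$ if satisfaction of $B$ at the empty prefix $\varepsilon$ implies satisfaction of $H$ at $\varepsilon$; $\Box(H\leftarrow B)$ is satisfied if this implication holds at every finite prefix of $\sigma$; $[a_1;\dots;a_h](H\leftarrow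 B)$ is satisfied if the implication holds at the prefix $a_1\dots a_h$. For a set $P$ of rules without default negation, $(\sigma,S)$ is a temporal answer set of $P$ if $S$ is $\subseteq$-minimal among the $S'$ such that $(\sigma,S')$ is a partial temporal interpretation satisfying the rules in $P$. For general $P$, the reduct $P^{(\sigma,S)}$ is the set of all rules $[a_1;\dots;a_h](H\leftarrow t_1,\dots,t_m)$ such that $a_1\dots a_h$ is a finite prefix of $\sigma$, $\Box(H\leftarrow t_1,\dots,t_m,not\,t_{m+1},\dots,not\,t_n)\in P$ and $(\sigma,S),a_1\dots a_h\not\models t_i$ for all $i=m+1,\dots,n$, together with, for each initial state law $H\leftarrow t_1,\dots,t_m,not\,t_{m+1},\dots,not\,t_n$ in $P$ with $(\sigma,S),\varepsilon\not\models t_i$ for $i=m+1,\dots,n$, the rule $H\leftarrow t_1,\dots,t_m$. $(\sigma,S)$ is a temporal answer set of $P$ if it is a temporal answer set of $P^{(\sigma,S)}$. $D=(\Pi,\mathcal{C})$ is well-defined if the temporal answer sets of $\Pi$ are total. **DLTL.** Programs: $\pi::=a\mid\pi_1+\pi_2\mid\pi_1;\pi_2\mid\pi^*$ ($a\in\Sigma$), i.e. regular expressions, with language $[[\pi]]\subseteq\Sigma^*$ defined as usual. Formulas: $p\mid\neg\alpha\mid\alpha\vee\beta\mid\alpha\,\mathcal{U}^\pi\beta$, with $p\in\mathcal{P}\cup\{\top,\bot\}$. A temporal model is $M=(\sigma,V)$ with $\sigma\in\Sigma^\omega$ and $V$ mapping each finite prefix of $\sigma$ to a subset of $\mathcal{P}$.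 For a finite prefix $\tau$ of $\sigma$: $M,\tau\models\top$; $M,\tau\not\models\bot$; $M,\tau\models p$ iff $p\in V(\tau)$; $\neg,\vee$ as usual; $M,\tau\models\alpha\,\mathcal{U}^\pi\beta$ iff there is $\tau'\in[[\pi]]$ such that $\tau\tau'$ is a prefix of $\sigma$, $M,\tau\tau'\models\beta$, and $M,\tau\tau''\models\alpha$ for every proper prefix $\tau''$ of $\tau'$ (including $\varepsilon$ when $\tau'\neq\varepsilon$). In the translation, until formulas are assumed to be indexed by finite automata instead of programs: $\alpha\,\mathcal{U}^{\mathcal{A}(q)}\beta$ where $\mathcal{A}=(Q,\delta,Q_F)$ is an $\varepsilon$-free nondeterministic finite automaton over $\Sigma$, $\delta:Q\times\Sigma\to2^Q$, $Q_F$ the final states, $q\in Q$ the initial state, and the language of $\mathcal{A}(q)$ is $[[\pi]]$. **Extensions.** A total temporal answer set $(\sigma,S)$ has the temporal model $M_S=(\sigma,V_S)$ with $p\in V_S(a_1\dots a_h)$ iff $[a_1;\dots;a_h]p\in S$. An extension of a well-defined $D=(\Pi,\mathcal{C})$ is a (total) temporal answer set $(\sigma,S)$ of $\Pi$ such that $M_S,\varepsilon\models\alpha$ for all $\alpha\in\mathcal{C}$. **Translation $tr(\Pi)$.** The translation looks for infinite models represented as $k$-loops (finite sequences of states $0,\dots,k$ with a back loop from state $k$ to a state $j\le k$), and a bound $k\ge0$ on the number of states is assumed. $tr(\Pi)$ is the following (grounded) standard answer set program with classical negation $\neg$ and default negation $not$. States are the integers $0,\dots,k+1$ (predicate $state$);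 $action$ and $fluent$ are given by facts. For a simple literal $(\neg)f$, write $(\neg)holds(f,S)$ for its translation at $S$. The rules are: - for $S\in\{0,\dots,k\}$: $\neg occurs(A,S)\leftarrow occurs(A_1,S)$ for all actions $A\ne A_1$; and $occurs(A,S)\leftarrow not\,\neg occurs(A,S)$ for all actions $A$; - for each action law with head $[a](\neg)f_0$ and each $S\in\{0,\dots,k\}$: $(\neg)holds(f_0,S+1)\leftarrow occurs(a,S),h_1,\dots,h_m,not\,h_{m+1},\dots,not\,h_n$, where $h_i=(\neg)holds(f_i,S+1)$ if $t_i=[a](\neg)f_i$ and $h_i=(\neg)holds(f_i,S)$ if $t_i=(\neg)f_i$; - for each dynamic causal law with head $\bigcirc(\neg)f_0$ and each $S\in\{0,\dots,k\}$: $(\neg)holds(f_0,S+1)\leftarrow h_1,\dots,h_m,not\,h_{m+1},\dots,not\,h_n$, where $h_i=(\neg)holds(f_i,S+1)$ if $t_i=\bigcirc(\neg)f_i$ and $h_i=(\neg)holds(f_i,S)$ if $t_i=(\neg)f_i$; - static causal laws: the analogous rule with head and body all at state $S$, for each $S\in\{0,\dots,k+1\}$; initial state laws: the analogous rule at state $0$ only; - laws whose head literal is $\bot$ are translated in the same way to constraints (rules with empty head); - loop rules: $\mathit{diff\_last}(S)\leftarrow holds(F,S),\neg holds(F,k+1)$ and $\mathit{diff\_last}(S)\leftarrow holds(F,k+1),\neg holds(F,S)$ and $\mathit{eq\_last}(S)\leftarrow not\,\mathit{diff\_last}(S)$, for $0\le S\le k$ and fluents $F$; $next(S,S+1)$ for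 $0\le S<k$; $\neg next(k,S)\leftarrow next(k,S')$ for all states $S\neq S'$; $next(k,S)\leftarrow not\,\neg next(k,S)$ for $0\le S\le k$; and the constraint $\leftarrow next(k,S),not\,\mathit{eq\_last}(S)$. **Translation $tr(D)$.** Formulas are represented by terms: fluents by themselves, $or(\cdot,\cdot)$, $neg(\cdot)$, and $until(A,q,t_\alpha,t_\beta)$ for $\alpha\,\mathcal{U}^{\mathcal{A}(q)}\beta$. $tr(D)$ consists of $tr(\Pi)$; the facts $trans(A,q_1,a,q_2)$ for $q_2\in\delta(q_1,a)$ and $final(A,q)$ for $q\in Q_F$, for each automaton $\mathcal{A}$ indexing an until formula in $\mathcal{C}$; for each $\alpha\in\mathcal{C}$, with representing term $t_\alpha$, the constraint $\leftarrow not\,sat(t_\alpha,0)$; and the following rules, grounded over the states and over the subformulas of formulas in $\mathcal{C}$ and the until formulas obtained from until subformulas $\gamma\,\mathcal{U}^{\mathcal{A}(q)}\beta$ by replacing $q$ with a state reachable from $q$ in $\mathcal{A}$: - $sat(true,S)$, where $true$ represents $\top$ (no rule for $\bot$); - $sat(F,S)\leftarrow fluent(F),holds(F,S)$; - $sat(or(X,Y),S)\leftarrow sat(X,S)$ and $sat(or(X,Y),S)\leftarrow sat(Y,S)$; - $sat(neg(X),S)\leftarrow not\,sat(X,S)$; - $sat(until(A,Q,X,Y),S)\leftarrow final(A,Q),sat(Y,S)$; - $sat(until(A,Q,X,Y),S)\leftarrow sat(X,S),trans(A,Q,Act,Q_1),occurs(Act,S),next(S,S_1),sat(until(A,Q_1,X,Y),S_1)$.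 **Temporal model of an answer set $R$ of $tr(D)$.** If $occurs(a_1,0),\dots,occurs(a_{k+1},k)$ and $next(k,j)$ belong to $R$, then $M_R=(\sigma_R,V_R)$ with $\sigma_R=a_1\dots a_j\,a_{j+1}\dots a_{k+1}\,a_{j+1}\dots a_{k+1}\dots$, and for $p\in\mathcal{P}$: $p\in V_R(\varepsilon)$ iff $holds(p,0)\in R$; $p\in V_R(a_1\dots a_h)$ iff $holds(p,h)\in R$ for $0<h\le k$; $p\in V_R(a_1\dots a_{k+1})$ iff $holds(p,j)\in R$; and so on periodically around the loop $j,\dots,k$.
   Formalization: For fixed k, the bijection is between pairs (extension, loop target j) whose model is a k-loop back to j, and answer sets where state k+1 has the same fluent literals as loop state j; as stated it fails for non-k-loop extensions, several loop targets, or partial last states. *)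

(* Defs.v *)
From mathcomp Require Import all_boot.
From mathcomp Require Import boolp classical_sets functions.

Set Implicit Arguments.
Unset Strict Implicit.
Unset Printing Implicit Defensive.

Local Open Scope classical_set_scope.

(* Literals over atoms of type T, with classical negation.  The same type is
   used for simple literals over fluents and for literals of the target answer
   set programs. *)
Inductive lit (T : Type) := Pos of T | Neg of T.

Definition consistent (T : Type) (X : set (lit T)) :=
  forall p, ~ (X (Pos p) /\ X (Neg p)).

Definition all_prop (T : Type) (P : T -> Prop) (s : seq T) : Prop :=
  foldr (fun x Q => P x /\ Q) True s.

(* [None] stands for falsity; only heads may be [None] (see [law]). *)
Inductive tlit (Sigma Fl : Type) :=
  | Simple of option (lit Fl)
  | After of Sigma & option (lit Fl)
  | Next of option (lit Fl).

Record trule (Sigma Fl : Type) := TRule {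
  thead : tlit Sigma Fl;
  tpos : seq (tlit Sigma Fl);
  tneg : seq (tlit Sigma Fl) }.

(* Body elements of action laws and dynamic causal laws: [Now l] is the simple
   literal l, and [Then l] is [a]l in an action law for a, and (next l) in a
   dynamic causal law. *)
Inductive step_lit (Fl : Type) := Now of lit Fl | Then of lit Fl.

Inductive law (Sigma Fl : Type) :=
  | ActionLaw (a : Sigma) (l0 : option (lit Fl)) (pos neg : seq (step_lit Fl))
  | StaticLaw (l0 : option (lit Fl)) (pos neg : seq (lit Fl))
  | DynamicLaw (l0 : option (lit Fl)) (pos neg : seq (step_lit Fl))
  | InitialLaw (l0 : option (lit Fl)) (pos neg : seq (lit Fl)).
Arguments StaticLaw {Sigma Fl}.
Arguments DynamicLaw {Sigma Fl}.
Arguments InitialLaw {Sigma Fl}.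

Section TemporalAnswerSets.
Variables (Sigma Fl : Type).

Definition simple_tlit (l : lit Fl) : tlit Sigma Fl := Simple Sigma (Some l).

Definition action_tlit (a : Sigma) (t : step_lit Fl) : tlit Sigma Fl :=
  match t with
  | Now l => simple_tlit l
  | Then l => After a (Some l)
  end.

Definition dynamic_tlit (t : step_lit Fl) : tlit Sigma Fl :=
  match t with
  | Now l => simple_tlit l
  | Then l => Next Sigma (Some l)
  end.

Definition law_rule (r : law Sigma Fl) : trule Sigma Fl :=
  match r with
  | ActionLaw a l0 pos neg =>
      TRule (After a l0) (map (action_tlit a) pos) (map (action_tlit a) neg)
  | StaticLaw l0 pos neg =>
      TRule (Simple Sigma l0) (map simple_tlit pos) (map simple_tlit neg)
  | DynamicLaw l0 pos neg =>
      TRule (Next Sigma l0) (map dynamic_tlit pos) (map dynamic_tlit neg)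
  | InitialLaw l0 pos neg =>
      TRule (Simple Sigma l0) (map simple_tlit pos) (map simple_tlit neg)
  end.

(* Whether the law is prefixed by the always operator. *)
Definition boxed (r : law Sigma Fl) : bool :=
  if r is InitialLaw _ _ _ then false else true.

(* The prefix of length n of the infinite word s. *)
Definition pref (s : nat -> Sigma) (n : nat) : seq Sigma := mkseq s n.

Definition is_prefix (s : nat -> Sigma) (tau : seq Sigma) : Prop :=
  exists n, tau = pref s n.

(* The pair (sigma, S); the element (a1...ak, l) of S is [a1;...;ak]l. *)
Record tinterp := TInterp {
  tword : nat -> Sigma;
  tlits : set (seq Sigma * lit Fl) }.

Definition partial_interp (E : tinterp) : Prop :=
  (forall tau l, tlits E (tau, l) -> is_prefix (tword E) tau) /\
  (forall tau f, ~ (tlits E (tau, Pos f) /\ tlits E (tau, Neg f))).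

Definition total_interp (E : tinterp) : Prop :=
  forall tau, is_prefix (tword E) tau ->
  forall f, tlits E (tau, Pos f) \/ tlits E (tau, Neg f).

Definition in_lits (E : tinterp) (tau : seq Sigma) (l : option (lit Fl)) : Prop :=
  if l is Some l' then tlits E (tau, l') else False.

Definition tsat (E : tinterp) (tau : seq Sigma) (t : tlit Sigma Fl) : Prop :=
  match t with
  | Simple l => in_lits E tau l
  | After a l => in_lits E (rcons tau a) l \/ ~ is_prefix (tword E) (rcons tau a)
  | Next l => exists b, is_prefix (tword E) (rcons tau b) /\ in_lits E (rcons tau b) l
  end.

(* The rule [a1;...;ah](H <- t1,...,tm), without default negation. *)
Record prule := PRule {
  pplace : seq Sigma;
  phead : tlit Sigma Fl;
  pbody : seq (tlit Sigma Fl) }.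

Definition prule_sat (E : tinterp) (r : prule) : Prop :=
  all_prop (tsat E (pplace r)) (pbody r) ->
  tsat E (pplace r) (phead r).

Definition positive_answer_set (P : set prule) (E : tinterp) : Prop :=
  let model S := let E' := TInterp (tword E) S in
    partial_interp E' /\ (forall r, P r -> prule_sat E' r) in
  model (tlits E) /\
  (forall S, model S -> S `<=` tlits E -> S = tlits E).

(* Initial state laws are kept only at the empty prefix. *)
Definition treduct (Pi : set (law Sigma Fl)) (E : tinterp) : set prule :=
  [set r | exists c tau, [/\ Pi c, is_prefix (tword E) tau,
     boxed c \/ tau = [::],
     all_prop (fun t => ~ tsat E tau t) (tneg (law_rule c)) &
     r = PRule tau (thead (law_rule c)) (tpos (law_rule c))]].

Definition temporal_answer_set (Pi : set (law Sigma Fl)) (E : tinterp) : Prop :=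
  positive_answer_set (treduct Pi E) E.

Definition default_initial_laws (Pi : set (law Sigma Fl)) : Prop :=
  forall f : Fl,
    Pi (InitialLaw (Some (Pos f)) [::] [:: Neg f]) /\
    Pi (InitialLaw (Some (Neg f)) [::] [:: Pos f]).

Definition well_defined_laws (Pi : set (law Sigma Fl)) : Prop :=
  forall E, temporal_answer_set Pi E -> total_interp E.

End TemporalAnswerSets.

Inductive prog (Sigma : Type) :=
  | PAct of Sigma
  | PSum of prog Sigma & prog Sigma
  | PSeq of prog Sigma & prog Sigma
  | PStar of prog Sigma.

Fixpoint prog_lang (Sigma : Type) (pi : prog Sigma) : set (seq Sigma) :=
  match pi with
  | PAct a => [set [:: a]]
  | PSum p1 p2 => prog_lang p1 `|` prog_lang p2
  | PSeq p1 p2 => [set w | exists w1 w2,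
      [/\ prog_lang p1 w1, prog_lang p2 w2 & w = w1 ++ w2]]
  | PStar p1 => [set w | exists2 ws : seq (seq Sigma),
      all_prop (prog_lang p1) ws & w = flatten ws]
  end.

Inductive dltl (Sigma Fl : Type) :=
  | FTrue
  | FFalse
  | FFl of Fl
  | FNeg of dltl Sigma Fl
  | FOr of dltl Sigma Fl & dltl Sigma Fl
  | FUntil of prog Sigma & dltl Sigma Fl & dltl Sigma Fl.

(* Only the values of [valu] on prefixes of [mword] are meaningful. *)
Record tmodel (Sigma Fl : Type) := TModel {
  mword : nat -> Sigma;
  valu : seq Sigma -> set Fl }.

Fixpoint holds_at (Sigma : eqType) (Fl : Type) (M : tmodel Sigma Fl)
    (tau : seq Sigma) (phi : dltl Sigma Fl) : Prop :=
  match phi with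
  | FTrue => True
  | FFalse => False
  | FFl p => valu M tau p
  | FNeg a => ~ holds_at M tau a
  | FOr a b => holds_at M tau a \/ holds_at M tau b
  | FUntil pi a b => exists tau',
      [/\ prog_lang pi tau', is_prefix (mword M) (tau ++ tau'),
          holds_at M (tau ++ tau') b &
          forall tau'', prefix tau'' tau' -> tau'' != tau' ->
            holds_at M (tau ++ tau'') a]
  end.

Record domain (Sigma Fl : Type) := Domain {
  laws : set (law Sigma Fl);
  constraints : set (dltl Sigma Fl) }.

Definition well_defined (Sigma Fl : Type) (D : domain Sigma Fl) : Prop :=
  well_defined_laws (laws D).

Definition model_of (Sigma Fl : Type) (E : tinterp Sigma Fl) : tmodel Sigma Fl :=
  TModel (tword E) (fun tau => [set p | tlits E (tau, Pos p)]).

Definition extension (Sigma : eqType) (Fl : Type) (D : domain Sigma Fl)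
    (E : tinterp Sigma Fl) : Prop :=
  [/\ temporal_answer_set (laws D) E, total_interp E &
      forall alpha, constraints D alpha -> holds_at (model_of E) [::] alpha].

(* Epsilon-free automata, with states numbered 0,...,n-1; the initial state is
   kept apart. *)
Record nfa (Sigma : Type) := Nfa {
  nfa_size : nat;
  nfa_step : 'I_nfa_size -> Sigma -> {set 'I_nfa_size};
  nfa_final : {set 'I_nfa_size} }.

Definition nfa_state (Sigma : Type) (A : nfa Sigma) : finType := 'I_(nfa_size A).

Fixpoint nfa_accept (Sigma : Type) (A : nfa Sigma) (q : nfa_state A)
    (w : seq Sigma) : bool :=
  if w is a :: w' then [exists q' in nfa_step q a, nfa_accept q' w']
  else q \in nfa_final A.

Definition nfa_reach (Sigma : finType) (A : nfa Sigma) (q q' : nfa_state A) : bool :=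
  connect [rel q1 q2 | [exists a, q2 \in nfa_step q1 a]] q q'.

Inductive term (Sigma Fl : Type) :=
  | TTrue
  | TFalse
  | TFl of Fl
  | TNeg of term Sigma Fl
  | TOr of term Sigma Fl & term Sigma Fl
  | TUntil (A : nfa Sigma) of nfa_state A & term Sigma Fl & term Sigma Fl.
Arguments TTrue {Sigma Fl}.
Arguments TFalse {Sigma Fl}.
Arguments TFl {Sigma Fl}.

(* [aut pi] with initial state [ini pi] is the automaton chosen for pi. *)
Fixpoint term_of (Sigma Fl : Type) (aut : prog Sigma -> nfa Sigma)
    (ini : forall pi, nfa_state (aut pi)) (phi : dltl Sigma Fl) : term Sigma Fl :=
  match phi with
  | FTrue => TTrue
  | FFalse => TFalse
  | FFl p => TFl p
  | FNeg a => TNeg (term_of ini a)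
  | FOr a b => TOr (term_of ini a) (term_of ini b)
  | FUntil pi a b => TUntil (ini pi) (term_of ini a) (term_of ini b)
  end.

Fixpoint subterm (Sigma Fl : Type) (t u : term Sigma Fl) : Prop :=
  t = u \/
  match u with
  | TTrue | TFalse | TFl _ => False
  | TNeg x => subterm t x
  | TOr x y => subterm t x \/ subterm t y
  | TUntil _ _ x y => subterm t x \/ subterm t y
  end.

Record rule (T : Type) := Rule {
  rhead : option (lit T);  (* [None]: a constraint *)
  rpos : seq (lit T);
  rneg : seq (lit T) }.

Section AnswerSets.
Variable T : Type.

Definition reduct (P : set (rule T)) (X : set (lit T)) : set (rule T) :=
  [set r | exists r', [/\ P r', all_prop (fun l => ~ X l) (rneg r') &
                          r = Rule (rhead r') (rpos r') [::]]].

(* For a set P of rules without default negation. *)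
Definition closed_under (P : set (rule T)) (X : set (lit T)) : Prop :=
  forall r, P r -> all_prop X (rpos r) ->
    if rhead r is Some l then X l else False.

(* Answer sets are consistent. *)
Definition answer_set (P : set (rule T)) (X : set (lit T)) : Prop :=
  [/\ consistent X, closed_under (reduct P X) X &
      forall Y, closed_under (reduct P X) Y -> Y `<=` X -> Y = X].

End AnswerSets.

Inductive atom (Sigma Fl : Type) :=
  | IsState of nat
  | IsAction of Sigma
  | IsFluent of Fl
  | Occurs of Sigma & nat
  | Holds of Fl & nat
  | NextSt of nat & nat
  | DiffLast of nat
  | EqLast of nat
  | Trans (A : nfa Sigma) of nfa_state A & Sigma & nfa_state A
  | Final (A : nfa Sigma) of nfa_state A
  | Sat of term Sigma Fl & nat.
Arguments IsState {Sigma Fl}.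
Arguments IsAction {Sigma Fl}.
Arguments IsFluent {Sigma Fl}.
Arguments Occurs {Sigma Fl}.
Arguments Holds {Sigma Fl}.
Arguments NextSt {Sigma Fl}.
Arguments DiffLast {Sigma Fl}.
Arguments EqLast {Sigma Fl}.
Arguments Trans {Sigma Fl A}.
Arguments Final {Sigma Fl A}.
Arguments Sat {Sigma Fl}.

Section Translation.
Variables (Sigma : finType) (Fl : Type).
Local Notation atom := (atom Sigma Fl).
Local Notation term := (term Sigma Fl).

Definition hlit (n : nat) (l : lit Fl) : lit atom :=
  match l with Pos f => Pos (Holds f n) | Neg f => Neg (Holds f n) end.

Definition hstep (n : nat) (t : step_lit Fl) : lit atom :=
  match t with Now l => hlit n l | Then l => hlit n.+1 l end.

Definition fact (p : atom) : rule atom := Rule (Some (Pos p)) [::] [::].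

Inductive tr_laws (k : nat) (Pi : set (law Sigma Fl)) : rule atom -> Prop :=
  | tr_state n : (n <= k.+1)%N -> tr_laws k Pi (fact (IsState n))
  | tr_is_action a : tr_laws k Pi (fact (IsAction a))
  | tr_is_fluent f : tr_laws k Pi (fact (IsFluent f))
  | tr_not_occurs a a1 n : (n <= k)%N -> a <> a1 ->
      tr_laws k Pi (Rule (Some (Neg (Occurs a n))) [:: Pos (Occurs a1 n)] [::])
  | tr_occurs a n : (n <= k)%N ->
      tr_laws k Pi (Rule (Some (Pos (Occurs a n))) [::] [:: Neg (Occurs a n)])
  | tr_action a l0 pos neg n : (n <= k)%N -> Pi (ActionLaw a l0 pos neg) ->
      tr_laws k Pi (Rule (omap (hlit n.+1) l0)
        (Pos (Occurs a n) :: map (hstep n) pos) (map (hstep n) neg))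
  | tr_dynamic l0 pos neg n : (n <= k)%N -> Pi (DynamicLaw l0 pos neg) ->
      tr_laws k Pi (Rule (omap (hlit n.+1) l0)
        (map (hstep n) pos) (map (hstep n) neg))
  | tr_static l0 pos neg n : (n <= k.+1)%N -> Pi (StaticLaw l0 pos neg) ->
      tr_laws k Pi (Rule (omap (hlit n) l0) (map (hlit n) pos) (map (hlit n) neg))
  | tr_initial l0 pos neg : Pi (InitialLaw l0 pos neg) ->
      tr_laws k Pi (Rule (omap (hlit 0) l0) (map (hlit 0) pos) (map (hlit 0) neg))
  | tr_diff_pos f n : (n <= k)%N ->
      tr_laws k Pi (Rule (Some (Pos (DiffLast n)))
        [:: Pos (Holds f n); Neg (Holds f k.+1)] [::])
  | tr_diff_neg f n : (n <= k)%N ->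
      tr_laws k Pi (Rule (Some (Pos (DiffLast n)))
        [:: Pos (Holds f k.+1); Neg (Holds f n)] [::])
  | tr_eq_last n : (n <= k)%N ->
      tr_laws k Pi (Rule (Some (Pos (EqLast n))) [::] [:: Pos (DiffLast n)])
  | tr_next_succ n : (n < k)%N -> tr_laws k Pi (fact (NextSt n n.+1))
  | tr_not_next n n' : (n <= k.+1)%N -> (n' <= k.+1)%N -> n <> n' ->
      tr_laws k Pi (Rule (Some (Neg (NextSt k n))) [:: Pos (NextSt k n')] [::])
  | tr_next n : (n <= k)%N ->
      tr_laws k Pi (Rule (Some (Pos (NextSt k n))) [::] [:: Neg (NextSt k n)])
  | tr_loop n : (n <= k)%N ->
      tr_laws k Pi (Rule None [:: Pos (NextSt k n)] [:: Pos (EqLast n)]).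

(* The terms over which the rules for [Sat] are grounded: subterms, and until
   subterms moved to a reachable state of their automaton. *)
Inductive term_closure (C : set term) : term -> Prop :=
  | term_closure_sub t u : C u -> subterm t u -> term_closure C t
  | term_closure_reach A (q q' : nfa_state A) x y u :
      C u -> subterm (TUntil q x y) u -> nfa_reach q q' ->
      term_closure C (TUntil q' x y).

(* C is the set of terms representing the constraints. *)
Inductive tr_terms (k : nat) (C : set term) : rule atom -> Prop :=
  | tr_trans A (q q1 : nfa_state A) x y u (a : Sigma) q2 :
      C u -> subterm (TUntil q x y) u -> q2 \in nfa_step q1 a ->
      tr_terms k C (fact (Trans q1 a q2))
  | tr_final A (q q1 : nfa_state A) x y u :
      C u -> subterm (TUntil q x y) u -> q1 \in nfa_final A ->
      tr_terms k C (fact (Final q1))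
  | tr_constraint u : C u ->
      tr_terms k C (Rule None [::] [:: Pos (Sat u 0)])
  | tr_sat_true n : (n <= k.+1)%N -> tr_terms k C (fact (Sat TTrue n))
  | tr_sat_fluent f n : (n <= k.+1)%N -> term_closure C (TFl f) ->
      tr_terms k C (Rule (Some (Pos (Sat (TFl f) n)))
        [:: Pos (IsFluent f); Pos (Holds f n)] [::])
  | tr_sat_orl x y n : (n <= k.+1)%N -> term_closure C (TOr x y) ->
      tr_terms k C (Rule (Some (Pos (Sat (TOr x y) n))) [:: Pos (Sat x n)] [::])
  | tr_sat_orr x y n : (n <= k.+1)%N -> term_closure C (TOr x y) ->
      tr_terms k C (Rule (Some (Pos (Sat (TOr x y) n))) [:: Pos (Sat y n)] [::])
  | tr_sat_neg x n : (n <= k.+1)%N -> term_closure C (TNeg x) ->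
      tr_terms k C (Rule (Some (Pos (Sat (TNeg x) n))) [::] [:: Pos (Sat x n)])
  | tr_sat_until_final A (q : nfa_state A) x y n :
      (n <= k.+1)%N -> term_closure C (TUntil q x y) ->
      tr_terms k C (Rule (Some (Pos (Sat (TUntil q x y) n)))
        [:: Pos (Final q); Pos (Sat y n)] [::])
  | tr_sat_until_step A (q q1 : nfa_state A) x y (a : Sigma) n n1 :
      (n <= k.+1)%N -> (n1 <= k.+1)%N ->
      term_closure C (TUntil q x y) -> term_closure C (TUntil q1 x y) ->
      tr_terms k C (Rule (Some (Pos (Sat (TUntil q x y) n)))
        [:: Pos (Sat x n); Pos (Trans q a q1); Pos (Occurs a n);
            Pos (NextSt n n1); Pos (Sat (TUntil q1 x y) n1)] [::]).

Definition tr_domain (aut : prog Sigma -> nfa Sigma)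
    (ini : forall pi, nfa_state (aut pi)) (k : nat) (D : domain Sigma Fl) :
    set (rule atom) :=
  [set r | tr_laws k (laws D) r \/ tr_terms k (term_of ini @` constraints D) r].

(* The state in 0..k visited at time i along 0,...,k with a back loop from k
   to j. *)
Definition loop_state (k j i : nat) : nat :=
  if (i <= k)%N then i else (j + (i - j) %% (k.+1 - j))%N.

(* [M] is represented by the k-loop with back loop to j. *)
Definition kloop (k j : nat) (M : tmodel Sigma Fl) : Prop :=
  (j <= k)%N /\ forall i,
    mword M i = mword M (loop_state k j i) /\
    valu M (pref (mword M) i) = valu M (pref (mword M) (loop_state k j i)).

(* [M] is the temporal model of the answer set [R], which contains next(k,j);
   this determines [M] on the prefixes of its word. *)
Definition is_model_of (k j : nat) (R : set (lit atom)) (M : tmodel Sigma Fl) : Prop :=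
  [/\ (j <= k)%N, R (Pos (NextSt k j)) &
      forall i, R (Pos (Occurs (mword M i) (loop_state k j i))) /\
        forall p, valu M (pref (mword M) i) p <-> R (Pos (Holds p (loop_state k j i)))].

(* State k+1 carries the same literals as the state the loop goes back to.  The
   rules for eq_last only exclude complementary literals, so without this a
   fluent may be undefined in one of the two states and defined in the other. *)
Definition genuine_loop (k : nat) (R : set (lit atom)) : Prop :=
  forall j, R (Pos (NextSt k j)) ->
  forall l, R (hlit k.+1 l) <-> R (hlit j l).

End Translation.

(* Main.v *)
(** Laws relate at most two consecutive states, so a pair (sigma, S) is a temporal
    answer set iff each of its states is an answer set of the laws evaluated at
    that state, given the previous state ([stable_state]).  The translation
    imposes exactly these conditions on the states 0,...,k+1, and the requirement
    that state k+1 repeats state j lets them be transferred along the unfolding of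
    the loop.  Everything else in an answer set of the translation is forced by
    the actions, the states and the loop point: [Sat] atoms are the truth values
    of the terms on the loop, the least fixpoint of the until rules being the
    existence of a finite accepting run.  Hence an answer set equals the explicit
    set [canonical]; only one inclusion is needed, as answer sets form an
    antichain. *)

Require Import Defs.
From mathcomp Require Import all_boot.
From mathcomp Require Import boolp classical_sets functions.
From mathcomp Require Import zify.

Set Implicit Arguments.
Unset Strict Implicit.
Unset Printing Implicit Defensive.

Local Open Scope classical_set_scope.

(** * Temporal answer sets state by state *)

Section AllProp.
Variables (S T : Type).
Implicit Types (P Q : T -> Prop).

Lemma all_prop_sub P Q (s : seq T) :
  (forall x, P x -> Q x) -> all_prop P s -> all_prop Q s.
Proof. by move=> PQ; elim: s => //= x s IHs [Px Ps]; split; auto. Qed.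

Lemma all_prop_map P (f : S -> T) (s : seq S) :
  all_prop P (map f s) <-> all_prop (fun x => P (f x)) s.
Proof. by elim: s => //= x s IHs; split=> -[? /IHs ?]. Qed.

End AllProp.

Section Prefixes.
Variable (Sigma : Type).
Implicit Types (s : nat -> Sigma).

Lemma size_pref s n : size (pref s n) = n.
Proof. exact: size_mkseq. Qed.

Lemma prefS s n : rcons (pref s n) (s n) = pref s n.+1.
Proof. by rewrite /pref mkseqS. Qed.

Lemma pref_inj s s' n n' : pref s n = pref s' n' -> n = n'.
Proof. by move=> /(congr1 size); rewrite !size_pref. Qed.

Lemma is_prefix_pref s n : is_prefix s (pref s n).
Proof. by exists n. Qed.

Lemma is_prefix_rcons s n a : is_prefix s (rcons (pref s n) a) <-> a = s n.
Proof.
split=> [[m] | ->]; last by rewrite prefS; apply: is_prefix_pref.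
move=> e; have em : n.+1 = m.
  by have := congr1 size e; rewrite size_rcons !size_pref.
by move: e; rewrite -em -prefS => /rcons_inj[].
Qed.

Lemma pref_addn s i m :
  pref s (i + m) = pref s i ++ map s (iota i m).
Proof. by rewrite /pref /mkseq iotaD map_cat. Qed.

End Prefixes.

Section LocalConditions.
Variables (Sigma Fl : Type).
Implicit Types (Pi : set (law Sigma Fl)) (H O X : set (lit Fl)).

Definition step_sat H X (t : step_lit Fl) : Prop :=
  match t with Now l => H l | Then l => X l end.

Definition head_sat X (l : option (lit Fl)) : Prop :=
  if l is Some l' then X l' else False.

(* [act] is the action leading to the current state, [None] in the initial
   state.  Default negation is evaluated in O at the current state and in H at
   the previous one, the rest of the law in X and G. *)
Definition law_sat (act : option Sigma) H O G X (c : law Sigma Fl) : Prop :=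
  match c, act with
  | StaticLaw l0 pos neg, _ | InitialLaw l0 pos neg, None =>
      all_prop (fun l => ~ O l) neg -> all_prop X pos -> head_sat X l0
  | ActionLaw a l0 pos neg, Some b => a = b ->
      all_prop (fun t => ~ step_sat H O t) neg ->
      all_prop (step_sat G X) pos -> head_sat X l0
  | DynamicLaw l0 pos neg, Some _ =>
      all_prop (fun t => ~ step_sat H O t) neg ->
      all_prop (step_sat G X) pos -> head_sat X l0
  | _, _ => True
  end.

(* O is an answer set of the laws on the current state, given the previous state
   H and the action [act] in between. *)
Definition stable_state Pi act H O : Prop :=
  [/\ consistent O,
      (forall c, Pi c -> law_sat act H O H O c) &
      forall X, X `<=` O -> (forall c, Pi c -> law_sat act H O H X c) -> X = O].

Definition arrival (s : nat -> Sigma) (n : nat) : option Sigma :=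
  if n is m.+1 then Some (s m) else None.

(** The previous state G enters only through positive bodies, so shrinking it makes fewer laws fire.
    Hence cutting down one state cannot break the laws leading into the next. *)
Lemma law_sat_weaken act H O G G' X c :
  G' `<=` G -> law_sat act H O G X c -> law_sat act H O G' X c.
Proof.
have w pos : G' `<=` G ->
    all_prop (step_sat G' X) pos -> all_prop (step_sat G X) pos.
  by move=> sub; apply: all_prop_sub => -[l /sub|].
move=> sub; case: c act => [a|||] l0 pos neg [b|] //= sat.
  by move=> ab neg_ok /(w _ sub); apply: sat.
by move=> neg_ok /(w _ sub); apply: sat.
Qed.

Definition state_at (s : nat -> Sigma) (S : set (seq Sigma * lit Fl)) (n : nat) :
  set (lit Fl) := [set l | S (pref s n, l)].

Section Reduct.
Variables (s : nat -> Sigma) (S : set (seq Sigma * lit Fl)).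
Let F := state_at s S.

Lemma tsat_action n t :
  tsat (TInterp s S) (pref s n) (action_tlit (s n) t) <-> step_sat (F n) (F n.+1) t.
Proof.
case: t => l //=; rewrite prefS; split=> [[//|[]]|]; last by left.
exact: is_prefix_pref.
Qed.

Lemma tsat_dynamic n t :
  tsat (TInterp s S) (pref s n) (dynamic_tlit Sigma t) <->
  step_sat (F n) (F n.+1) t.
Proof.
case: t => l //=; split=> [[b [/is_prefix_rcons ->]]|Sl]; rewrite ?prefS //.
by exists (s n); rewrite prefS; split=> //; apply: is_prefix_pref.
Qed.

End Reduct.

(** Laws are regrouped by the state that their head constrains: an action or dynamic law placed at
    prefix n concerns state n+1, a static law state n itself. At n = 0 the value [0.-1] is harmless,
    since with arrival [None] no law looks at a previous state. *)
Lemma treductP Pi s S S' (F := state_at s S) (G := state_at s S') :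
  (forall r, treduct Pi (TInterp s S) r -> prule_sat (TInterp s S') r) <->
  forall n c, Pi c ->
    law_sat (arrival s n) (F n.-1) (F n) (G n.-1) (G n) c.
Proof.
split.
  move=> sat n c Pic.
  have use m : boxed c \/ m = 0 ->
      all_prop (fun t => ~ tsat (TInterp s S) (pref s m) t) (tneg (law_rule c)) ->
      all_prop (tsat (TInterp s S') (pref s m)) (tpos (law_rule c)) ->
      tsat (TInterp s S') (pref s m) (Defs.thead (law_rule c)).
    move=> bc neg pos.
    pose lr := law_rule c.
    apply: (sat (PRule (pref s m) (Defs.thead lr) (tpos lr))) => //.
    exists c, (pref s m); split=> //; first exact: is_prefix_pref.
    by case: bc => [|->]; [left|right].
  case: c Pic use => [a|||] l0 pos neg Pic /= use; case: n => [|n] //=.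
  - move=> ea neg_ok pos_ok; rewrite {}ea in Pic use.
    have := use n (or_introl erefl); rewrite prefS; case.
    + by apply/all_prop_map; apply: all_prop_sub neg_ok => t + /tsat_action.
    + by apply/all_prop_map; apply: all_prop_sub pos_ok => t /tsat_action.
    + by case: (l0).
    + by case; apply: is_prefix_pref.
  - by move=> neg_ok pos_ok; apply: (use 0 (or_introl erefl)); apply/all_prop_map.
  - by move=> neg_ok pos_ok; apply: (use n.+1 (or_introl erefl)); apply/all_prop_map.
  - move=> neg_ok pos_ok.
    have := use n (or_introl erefl); case.
    + by apply/all_prop_map; apply: all_prop_sub neg_ok => t + /tsat_dynamic.
    + by apply/all_prop_map; apply: all_prop_sub pos_ok => t /tsat_dynamic.
    + by move=> b [/is_prefix_rcons ->]; rewrite prefS; case: (l0).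
  - by move=> neg_ok pos_ok; apply: (use 0 (or_intror erefl)); apply/all_prop_map.
move=> sat _ [c [_ [Pic [n ->] /= bc neg_ok ->]]]; rewrite /prule_sat /= => pos_ok.
case: c Pic bc neg_ok pos_ok => [a|||] l0 pos neg Pic bc /=
  /all_prop_map neg_ok /all_prop_map pos_ok.
(* For an action other than the next one of the word, the head holds vacuously. *)
- have [ea|na] := pselect (a = s n); last by right=> /is_prefix_rcons.
  rewrite {}ea in Pic neg_ok pos_ok *.
  left; rewrite prefS; apply: (sat n.+1 _ Pic erefl).
    by apply: all_prop_sub neg_ok => t + /tsat_action.
  by apply: all_prop_sub pos_ok => t /tsat_action.
- by have := sat n _ Pic; case: n {bc} neg_ok pos_ok => [|n] neg_ok pos_ok; apply.
- exists (s n); split; first exact/is_prefix_rcons.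
  rewrite prefS; apply: (sat n.+1 _ Pic).
    by apply: all_prop_sub neg_ok => t + /tsat_dynamic.
  by apply: all_prop_sub pos_ok => t /tsat_dynamic.
- case: bc => // n0; have {n0} n0 : n = 0 by rewrite -(size_pref s n) n0.
  by rewrite {}n0 in neg_ok pos_ok *; apply: (sat 0 _ Pic).
Qed.

(** Global and local minimality agree because influence runs forward only. A smaller state can be
    substituted at one place without violating later laws; conversely, a smaller model agrees with S
    state by state, starting from the initial one. *)
Lemma temporal_answer_setP Pi s S (F := state_at s S) :
  temporal_answer_set Pi (TInterp s S) <->
  (forall tau l, S (tau, l) -> is_prefix s tau) /\
  (forall n, stable_state Pi (arrival s n) (F n.-1) (F n)).
Proof.
rewrite /temporal_answer_set /positive_answer_set /partial_interp /=.
split=> [[[[supp cons] /treductP sat] min]|[supp stable]].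
  split=> // n; split=> [f|c Pic|X XF Xsat]; [exact: cons | exact: sat |].
  pose S' := [set x | S x /\ (x.1 = pref s n -> X x.2)].
  have S'S : S' `<=` S by move=> x [].
  have S'n : state_at s S' n = X.
    by apply/seteqP; split=> l; [case=> _; apply|move=> Xl; split=> //; apply: XF].
  have S'm m : m != n -> state_at s S' m = F m.
    move=> mn; apply/seteqP; split=> l; first by case.
    by move=> Fl'; split=> //= /pref_inj e; rewrite e eqxx in mn.
  suff SS' : S' = S by rewrite -S'n SS'.
  apply: min S'S; split.
    split; first by move=> tau l [/supp].
    by move=> tau f [[Sp _] [Sn _]]; apply: (cons tau f).
  apply/treductP => m c Pic.
  have sub : state_at s S' m.-1 `<=` F m.-1 by move=> l [].
  apply: law_sat_weaken sub _.
  have [->|mn] := eqVneq m n; first by rewrite S'n; apply: Xsat.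
  by rewrite S'm //; apply: sat.
have pair x : S x -> exists n, x = (pref s n, x.2).
  by case: x => tau l /supp [n ->]; exists n.
split; first split=> //.
- split=> // tau f [Sp Sn]; have [n etau] := supp _ _ Sp.
  by rewrite etau in Sp Sn; case: (stable n) => cons _ _; apply: (cons f).
- by apply/treductP => n c Pic; case: (stable n) => _ + _; apply.
- move=> S' [_ /treductP sat] S'S.
  suff eqF n : state_at s S' n = F n.
    apply/seteqP; split=> // x Sx; have [n ex] := pair x Sx.
    have : F n x.2 by rewrite /F /state_at /= -ex.
    by rewrite -eqF /state_at /= -ex.
  (* Once state n agrees, state n+1 of S' satisfies the laws relative to the right predecessor, so
     local minimality applies. *)
  elim: n => [|n IHn].
    case: (stable 0) => _ _; apply; first by move=> l /S'S.
    by move=> c Pic; have := sat 0 _ Pic; case: (c).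
  case: (stable n.+1) => _ _; apply; first by move=> l /S'S.
  by move=> c Pic; have := sat n.+1 _ Pic; rewrite /= IHn.
Qed.

End LocalConditions.

(** * Answer sets of the translation *)

Section AnswerSetTheory.
Variables (T : Type) (P : set (rule T)).
Implicit Types (X Y Z : set (lit T)).

Lemma closed_reductP X Y :
  closed_under (reduct P X) Y <->
  forall r, P r -> all_prop (fun l => ~ X l) (rneg r) -> all_prop Y (rpos r) ->
    head_sat Y (rhead r).
Proof.
split=> [clo r Pr neg pos|clo _ [r [Pr neg ->]]]; last first.
  by move=> /= pos; apply: clo.
by apply: (clo (Rule (rhead r) (rpos r) [::])) => //; exists r.
Qed.

(** Rule induction on the reduct: the intersection of X with Z is again closed, so minimality makes
    it all of X. Constraints demand nothing of Z, since their bodies already fail in X. *)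
Lemma answer_set_sub X Z :
  answer_set P X ->
  (forall r, P r -> all_prop (fun l => ~ X l) (rneg r) ->
    all_prop (X `&` Z) (rpos r) -> if rhead r is Some l then Z l else True) ->
  X `<=` Z.
Proof.
case=> _ /closed_reductP clo min XZ.
suff <- : X `&` Z = X by move=> l [].
apply: min; last by move=> l [].
apply/closed_reductP => r Pr neg pos.
have posX : all_prop X (rpos r) by apply: all_prop_sub pos => l [].
have := clo r Pr neg posX.
by have := XZ r Pr neg pos; case: (rhead r).
Qed.

(** A larger set has a smaller reduct, so X is also closed under the reduct by Y, and minimality of
    Y applies. *)
Lemma answer_set_antichain X Y :
  answer_set P X -> answer_set P Y -> X `<=` Y -> X = Y.
Proof.
case=> _ /closed_reductP closedX _ [_ _ min] XY; apply: (min X) => //.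
apply/closed_reductP => r Pr neg; apply: closedX => //.
by apply: all_prop_sub neg => l nYl /XY.
Qed.

End AnswerSetTheory.

(** * Terms and their truth on the loop *)

Section TermStructure.
Variables (Sigma Fl : Type).
Local Notation term := (term Sigma Fl).

Definition on_children (P : term -> Prop) (t : term) : Prop :=
  match t with
  | TNeg x => P x
  | TOr x y | TUntil _ _ x y => P x /\ P y
  | _ => True
  end.

(** A single induction hypothesis for all constructors, so that the step for a term can be a
    separate lemma about its children. *)
Lemma term_children_ind (P : term -> Prop) :
  (forall t, on_children P t -> P t) -> forall t, P t.
Proof. by move=> IH; elim=> *; apply: IH. Qed.

Lemma on_children_mp (P Q : term -> Prop) t :
  on_children (fun x => P x -> Q x) t -> on_children P t -> on_children Q t.
Proof. by case: t => //= *; intuition. Qed.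

Lemma on_children_all (P : term -> Prop) t : (forall x, P x) -> on_children P t.
Proof. by case: t => /=; auto. Qed.

Lemma subterm_refl (t : term) : subterm t t.
Proof. by case: t => *; left. Qed.

Lemma subterm_trans (t u v : term) : subterm t u -> subterm u v -> subterm t v.
Proof.
move=> tu; elim: v => [||f|x IHx|x IHx y IHy|A q x IHx y IHy] [<- //|] //=.
- by move=> /IHx; right.
- by case=> [/IHx|/IHy]; right; [left|right].
- by case=> [/IHx|/IHy]; right; [left|right].
Qed.

End TermStructure.

Section TermSemantics.
Variables (Sigma : Type) (Fl : Type).
Local Notation term := (term Sigma Fl).
Variables (k j : nat) (s : nat -> Sigma) (F : nat -> set (lit Fl)).

Definition next_state (n : nat) : nat := if n < k then n.+1 else j.

(** The least fixpoint of the two until rules. The guard [n <= k] matters because [next_state] is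
    total and would send k+1 to j, although no action occurs at k+1. *)
Inductive until_holds (A : nfa Sigma) (P Q : nat -> Prop) :
    nfa_state A -> nat -> Prop :=
  | until_final q n : q \in nfa_final A -> Q n -> until_holds P Q q n
  | until_step (q q1 : nfa_state A) n : n <= k -> P n -> q1 \in nfa_step q (s n) ->
      until_holds P Q q1 (next_state n) -> until_holds P Q q n.

(* State k+1 has no successor, so an until formula holds there only through a
   final state of its automaton. *)
Fixpoint term_holds (t : term) (n : nat) : Prop :=
  match t with
  | TTrue => True
  | TFalse => False
  | TFl f => F n (Pos f)
  | TNeg x => ~ term_holds x n
  | TOr x y => term_holds x n \/ term_holds y n
  | TUntil A q x y => until_holds (term_holds x) (term_holds y) q n
  end.

End TermSemantics.

Section Translated.
Variables (Sigma : finType) (Fl : Type) (k : nat).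
Variables (Pi : set (law Sigma Fl)) (C : set (term Sigma Fl)).
Local Notation atom := (atom Sigma Fl).
Local Notation term := (term Sigma Fl).
Implicit Types (X Y R : set (lit atom)).

Definition translation : set (rule atom) :=
  [set r | tr_laws k Pi r \/ tr_terms k C r].

Lemma translation_laws r : tr_laws k Pi r -> translation r.
Proof. by left. Qed.

Lemma translation_terms r : tr_terms k C r -> translation r.
Proof. by right. Qed.

Lemma term_closure_children (t : term) :
  term_closure C t -> on_children (term_closure C) t.
Proof.
have sub u v w : C w -> subterm u v -> subterm v w -> term_closure C u.
  by move=> Cw uv vw; apply: term_closure_sub Cw (subterm_trans uv vw).
case=> [{}t u Cu tu|A q q' x y u Cu tu _].
  case: t tu => [||f|x|x y|A q x y] //= tu; try split; apply: sub Cu _ tu => /=;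
    by right; auto using subterm_refl.
by split; apply: sub Cu _ tu => /=; right; auto using subterm_refl.
Qed.

Lemma term_closure_until A (q : nfa_state A) (x y : term) :
  term_closure C (TUntil q x y) ->
  exists2 u, C u & exists2 q0, subterm (TUntil q0 x y) u & nfa_reach q0 q.
Proof.
(* The type of q depends on A; stating the claim by matching on a term avoids inverting an equality
   between dependent pairs. *)
move=> clos; pose P t := match t with
  | TUntil A q x y => exists2 u, C u &
      exists2 q0 : nfa_state A, subterm (TUntil q0 x y) u & nfa_reach q0 q
  | _ => True end.
suff: P (TUntil q x y) by [].
case: clos => [t u Cu tu|A' q0 q' x' y' u Cu tu reach].
  case: t tu => //= A' q' x' y' tu; exists u => //; exists q' => //.
  exact: connect0.
by exists u => //; exists q0.
Qed.

Lemma term_closure_step A (q q1 : nfa_state A) (x y : term) a :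
  term_closure C (TUntil q x y) -> q1 \in nfa_step q a ->
  term_closure C (TUntil q1 x y).
Proof.
move=> /term_closure_until [u Cu [q0 sub reach]] step.
apply: term_closure_reach Cu sub (connect_trans reach (connect1 _)) => /=.
by apply/existsP; exists a.
Qed.

Definition lits_at X n : set (lit Fl) := [set l | X (hlit Sigma n l)].

Lemma hstepE X n t :
  X (hstep Sigma n t) <-> step_sat (lits_at X n) (lits_at X n.+1) t.
Proof. by case: t. Qed.

Lemma head_hlit X n l :
  head_sat X (omap (hlit Sigma n) l) <-> head_sat (lits_at X n) l.
Proof. by case: l. Qed.

(** X determines the reduct and Y is the closed set: they coincide when reading off an answer set,
    and differ when proving minimality. *)
Lemma closed_law_sat X Y s n c :
  closed_under (reduct translation X) Y ->
  (forall m, m <= k -> Y (Pos (Occurs (s m) m))) ->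
  n <= k.+1 -> Pi c ->
  law_sat (arrival s n) (lits_at X n.-1) (lits_at X n)
    (lits_at Y n.-1) (lits_at Y n) c.
Proof.
move=> /closed_reductP clo occ nk Pic.
case: c Pic => [a|||] l0 pos neg Pic; case: n nk => [|n] //= nk.
- move=> ea neg_ok pos_ok; rewrite {}ea in Pic.
  rewrite ltnS in nk; apply/head_hlit.
  apply: (clo _ (translation_laws (tr_action nk Pic))) => /=.
    by apply/all_prop_map; apply: all_prop_sub neg_ok => t + /(hstepE X).
  split; first exact: occ.
  by apply/all_prop_map; apply: all_prop_sub pos_ok => t /(hstepE Y).
- move=> neg_ok pos_ok; apply/head_hlit.
  by apply: (clo _ (translation_laws (tr_static nk Pic))); apply/all_prop_map.
- move=> neg_ok pos_ok; apply/head_hlit.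
  by apply: (clo _ (translation_laws (tr_static nk Pic))); apply/all_prop_map.
- move=> neg_ok pos_ok.
  rewrite ltnS in nk; apply/head_hlit.
  apply: (clo _ (translation_laws (tr_dynamic nk Pic))) => /=.
    by apply/all_prop_map; apply: all_prop_sub neg_ok => t + /(hstepE X).
  by apply/all_prop_map; apply: all_prop_sub pos_ok => t /(hstepE Y).
- move=> neg_ok pos_ok; apply/head_hlit.
  by apply: (clo _ (translation_laws (tr_initial k Pic))); apply/all_prop_map.
Qed.

(* [tr_laws k set0] consists of the rules of tr(Pi) that translate no law. *)
Lemma tr_laws_sat X Y s :
  (forall a n, n <= k -> Y (Pos (Occurs a n)) -> a = s n) ->
  (forall n c, n <= k.+1 -> Pi c -> law_sat (arrival s n)
     (lits_at X n.-1) (lits_at X n) (lits_at Y n.-1) (lits_at Y n) c) ->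
  (forall r, tr_laws k set0 r -> all_prop (fun l => ~ X l) (rneg r) ->
     all_prop Y (rpos r) -> head_sat Y (rhead r)) ->
  forall r, tr_laws k Pi r -> all_prop (fun l => ~ X l) (rneg r) ->
    all_prop Y (rpos r) -> head_sat Y (rhead r).
Proof.
move=> occ sat Wo _ [].
all: try by move=> *; apply: Wo => //; constructor.
- move=> a l0 pos neg n nk Pic neg_ok pos_ok /=.
  apply/head_hlit; case: pos_ok => /= /(occ _ _ nk) ea /all_prop_map pos_ok.
  move/all_prop_map: neg_ok => neg_ok.
  apply: (sat n.+1 _ nk Pic ea).
    by apply: all_prop_sub neg_ok => t + /(hstepE X).
  by apply: all_prop_sub pos_ok => t /(hstepE Y).
- move=> l0 pos neg n nk Pic neg_ok pos_ok.
  move/all_prop_map: neg_ok => neg_ok; move/all_prop_map: pos_ok => pos_ok.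
  apply/head_hlit; apply: (sat n.+1 _ nk Pic).
    by apply: all_prop_sub neg_ok => t + /(hstepE X).
  by apply: all_prop_sub pos_ok => t /(hstepE Y).
- move=> l0 pos neg n nk Pic neg_ok pos_ok; apply/head_hlit.
  move/all_prop_map: neg_ok => neg_ok; move/all_prop_map: pos_ok => pos_ok.
  by have := sat n _ nk Pic; case: n {nk} neg_ok pos_ok => [|n] neg_ok pos_ok; apply.
- move=> l0 pos neg Pic neg_ok pos_ok; apply/head_hlit.
  move/all_prop_map: neg_ok => neg_ok; move/all_prop_map: pos_ok => pos_ok.
  exact: (sat 0 _ _ Pic).
Qed.

Section TermTruth.
Variables (j : nat) (s : nat -> Sigma) (F : nat -> set (lit Fl)).
Local Notation truth := (term_holds k j s F).
Local Notation succ := (next_state k j).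

Definition complete Y (t : term) : Prop :=
  forall n, n <= k.+1 -> truth t n -> Y (Pos (Sat t n)).

Definition sound X (t : term) : Prop :=
  forall n, n <= k.+1 -> X (Pos (Sat t n)) -> truth t n.

Lemma next_state_le n : j <= k -> n <= k -> succ n <= k.
Proof. by rewrite /next_state; case: ifP. Qed.

(** Soundness of the children is needed for negation: if x is false, [Sat x] is not in X, so the
    rule for [TNeg x] survives in the reduct. Until terms follow the derivation of their truth. *)
Lemma complete_step X Y t :
  closed_under (reduct translation X) Y -> j <= k ->
  (forall n, n <= k -> Y (Pos (Occurs (s n) n))) ->
  (forall n, n <= k -> Y (Pos (NextSt n (succ n)))) ->
  (forall n f, n <= k.+1 -> F n (Pos f) -> Y (Pos (Holds f n))) ->
  term_closure C t ->
  on_children (complete Y) t -> on_children (sound X) t -> complete Y t.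
Proof.
move=> /closed_reductP clo jk occ next holds.
have use r : tr_terms k C r -> all_prop (fun l => ~ X l) (rneg r) ->
    all_prop Y (rpos r) -> head_sat Y (rhead r).
  by move=> /translation_terms /clo.
case: t => [||f|x|x y|A q x y] ct /= comp snd n nk.
- by move=> _; apply: (use _ (tr_sat_true C nk)).
- by [].
- move=> Ff; apply: (use _ (tr_sat_fluent nk ct)) => //=; split.
    exact: (clo _ (translation_laws (tr_is_fluent k Pi f))).
  by split=> //; apply: holds.
- move=> nx; apply: (use _ (tr_sat_neg nk ct)) => //=; split=> //.
  by move=> /(snd _ nk).
- case: comp => compx compy; case=> [/(compx _ nk) ?|/(compy _ nk) ?].
    exact: (use _ (tr_sat_orl nk ct)).
  exact: (use _ (tr_sat_orr nk ct)).
- case: comp => compx compy until.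
  elim: until nk ct => [{}q {}n|{}q q1 {}n].
    move=> fin /compy Yy nk ct; apply: (use _ (tr_sat_until_final nk ct)) => //=.
    have [u Cu [q0 sub _]] := term_closure_until ct.
    split; first exact: (use _ (tr_final k Cu sub fin)).
    by split=> //; apply: Yy.
  move=> n_k /compx Yx step _ IH nk ct.
  have ct1 := term_closure_step ct step.
  have n1k := leqW (next_state_le jk n_k).
  apply: (use _ (tr_sat_until_step (s n) nk n1k ct ct1)) => //=.
  have [u Cu [q0 sub _]] := term_closure_until ct.
  split; first exact: Yx.
  split; first exact: (use _ (tr_trans k Cu sub step)).
  by split; [exact: occ|split; [exact: next|split=> //; apply: IH]].
Qed.

(** Dually, negation needs completeness of the child: were x true, [Sat x] would be in R and the
    rule would be deleted. *)
Lemma sound_step R t :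
  answer_set translation R ->
  (forall n a, R (Pos (Occurs a n)) -> n <= k /\ a = s n) ->
  (forall n n', n <= k -> R (Pos (NextSt n n')) -> n' = succ n) ->
  (forall n f, n <= k.+1 -> R (Pos (Holds f n)) -> F n (Pos f)) ->
  on_children (sound R) t -> on_children (complete R) t -> sound R t.
Proof.
move=> ansR occ next holds sndt compt n nk Rt.
(* The assumptions on the children sit inside Z, so they carry over when the until rule moves to
   another automaton state with the same children. *)
pose Z : set (lit atom) := fun l => match l with
  | Pos (Trans A q a q') => q' \in nfa_step q a
  | Pos (Final A q) => q \in nfa_final A
  | Pos (Sat t n) => on_children (sound R) t -> on_children (complete R) t ->
      truth t n
  | _ => True
  end.
suff /(_ _ Rt) : R `<=` Z by apply.
apply: answer_set_sub ansR _ => {t sndt compt n nk Rt} _ [[]|[]] //=.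
- by move=> a [[]|].
- by move=> [[]|].
- by move=> [[]|] //= n0 ? ? m.
- by move=> [[]|] //= n0 ? ? m.
- by move=> n f nk _ _ [_ [[/(holds _ _ nk)]]].
- by move=> x y n nk _ _ [[Rx _] _] [snd _] _; left; apply: snd.
- by move=> x y n nk _ _ [[Ry _] _] [_ snd] _; right; apply: snd.
- by move=> x n nk _ [nR _] _ _ comp /(comp _ nk).
- move=> A q x y n nk _ _ [[_ fin] [[Ry _] _]] [_ snd] _.
  by apply: until_final => //; apply: snd.
- move=> A q q1 x y a n n1 nk _ _ _ _.
  case=> -[Rx _] [[_ step] [[/occ[n_k ea] _] [[Rn _] [[_ Z1] _]]]] snd comp.
  rewrite {}ea in step; move: Z1; rewrite (next _ _ n_k Rn) => Z1.
  apply: until_step step _ => //; last exact: Z1.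
  by case: snd => + _; apply.
Qed.

End TermTruth.

(** * The explicit answer set *)

Section Canonical.
Variables (j : nat) (s : nat -> Sigma) (F : nat -> set (lit Fl)).
Local Notation truth := (term_holds k j s F).
Local Notation succ := (next_state k j).

Definition differs_from_last n : Prop := exists f,
  F n (Pos f) /\ F k.+1 (Neg f) \/ F k.+1 (Pos f) /\ F n (Neg f).

(** The alternative [t = TTrue] reflects that the facts for [TTrue] are not restricted to the
    closure of C. *)
Definition canonical : set (lit atom) := fun l => match l with
  | Pos (IsState n) => n <= k.+1
  | Pos (IsAction _) | Pos (IsFluent _) => True
  | Pos (Occurs a n) => n <= k /\ a = s n
  | Pos (Holds f n) => n <= k.+1 /\ F n (Pos f)
  | Pos (NextSt n n') => n <= k /\ n' = succ n
  | Pos (DiffLast n) => n <= k /\ differs_from_last n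
  | Pos (EqLast n) => n <= k /\ ~ differs_from_last n
  | Pos (Trans A q a q') => q' \in nfa_step q a /\
      exists x y u q0, C u /\ subterm (@TUntil _ _ A q0 x y) u
  | Pos (Final A q) => q \in nfa_final A /\
      exists x y u q0, C u /\ subterm (@TUntil _ _ A q0 x y) u
  | Pos (Sat t n) => [/\ n <= k.+1, t = TTrue \/ term_closure C t & truth t n]
  | Neg (Occurs a n) => n <= k /\ a <> s n
  | Neg (Holds f n) => n <= k.+1 /\ F n (Neg f)
  | Neg (NextSt n n') => [/\ n = k, n' <= k.+1 & n' <> j]
  | _ => False
  end.

Lemma lits_at_canonical n : n <= k.+1 -> lits_at canonical n = F n.
Proof.
by move=> nk; apply/seteqP; split=> -[f|f] /=; rewrite /lits_at /=; [case|case| |].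
Qed.

Definition stable_states : Prop :=
  forall n, n <= k.+1 -> stable_state Pi (arrival s n) (F n.-1) (F n).

Lemma canonical_closed :
  j <= k -> stable_states -> ~ differs_from_last j ->
  (forall u, C u -> truth u 0) ->
  closed_under (reduct translation canonical) canonical.
Proof.
move=> jk stable same sat; apply/closed_reductP => r [].
  apply: (@tr_laws_sat _ _ s) => [a n _ []|n c nk Pic|{}r] //.
    rewrite !lits_at_canonical //; last by case: n nk => //= n /ltnW.
    by case: (stable n nk) => _ + _; apply.
  case=> //=.
  - by move=> a a1 n nk aa1 _ [[_ <-] _].
  - by move=> a n nk [na _] _; split=> //; apply: contrapT => ?; apply: na.
  - by move=> f n nk _ [[_ Fp] [[_ Fn] _]]; split=> //; exists f; left.
  - by move=> f n nk _ [[_ Fp] [[_ Fn] _]]; split=> //; exists f; right.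
  - by move=> n nk [nd _] _; split=> // d; apply: nd.
  - by move=> n nk; rewrite /next_state nk ltnW.
  - move=> n n' nk nk' nn' _ [[_ e] _]; split=> // nj; apply: nn'.
    by rewrite nj e /next_state ltnn.
  - move=> n nk [nn _] _; split=> //; rewrite /next_state ltnn.
    by apply: contrapT => nj; apply: nn; split=> //; apply: leqW.
  - move=> n nk [ne _] [[_ nj] _]; apply: ne; split=> //.
    by rewrite nj /next_state ltnn.
case=> //=.
- by move=> A q q1 x y u a q2 Cu sub step _ _; split=> //; exists x, y, u, q.
- by move=> A q q1 x y u Cu sub step _ _; split=> //; exists x, y, u, q.
- move=> u Cu [nsat _] _; apply: nsat; split=> //; last exact: sat.
  by right; apply: term_closure_sub Cu _; apply: subterm_refl.
- by move=> n nk _ _; split=> //; left.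
- by move=> f n nk cf _ [_ [[_ Ff] _]]; split=> //; right.
- by move=> x y n nk cf _ [[_ _ tx] _]; split=> //; [right|left].
- by move=> x y n nk cf _ [[_ _ tx] _]; split=> //; [right|right].
- move=> x n nk cf [nx _] _; split=> //; first by right.
  move=> tx; apply: nx; split=> //.
  by right; apply: (term_closure_children cf).
- move=> A q x y n nk cf _ [[fin _] [[_ _ ty] _]]; split=> //; first by right.
  exact: until_final.
- move=> A q q1 x y a n n1 nk n1k cq cq1 _.
  case=> -[_ _ tx] [[step _] [[n_k ea] [[_ en] [[_ _ tq1] _]]]].
  rewrite {}ea {}en in step tq1 *.
  by split=> //; [right|apply: until_step step tq1].
Qed.

(** For minimality, a closed subset Y recovers everything in order: actions and successors from the
    defaults, then the states, then the terms, then the loop atoms. *)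
Lemma canonical_answer_set :
  j <= k -> stable_states -> ~ differs_from_last j ->
  (forall u, C u -> truth u 0) ->
  answer_set translation canonical.
Proof.
move=> jk stable same sat; split; last first.
- move=> Y closedY YR; apply/seteqP; split=> // l.
  have /closed_reductP clo := closedY.
  have use r : tr_laws k Pi r -> all_prop (fun l => ~ canonical l) (rneg r) ->
      all_prop Y (rpos r) -> head_sat Y (rhead r).
    by move=> /translation_laws /clo.
  have use' r : tr_terms k C r -> all_prop (fun l => ~ canonical l) (rneg r) ->
      all_prop Y (rpos r) -> head_sat Y (rhead r).
    by move=> /translation_terms /clo.
  have occ n : n <= k -> Y (Pos (Occurs (s n) n)).
    by move=> nk; apply: (use _ (tr_occurs Pi (s n) nk)) => //=; split=> // -[].
  have nextk : Y (Pos (NextSt k j)).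
    by apply: (use _ (tr_next Pi jk)) => //=; split=> // -[].
  have next n : n <= k -> Y (Pos (NextSt n (succ n))).
    rewrite /next_state; case: ltnP => [nk _|kn nk].
      exact: (use _ (tr_next_succ Pi nk)).
    by have -> : n = k by apply/eqP; rewrite eqn_leq nk kn.
  (* Y only has literals of F at state n and satisfies the laws there given the recovered
     predecessor, so local minimality of F gives equality. *)
  have holds n : n <= k.+1 -> lits_at Y n = F n.
    elim: n => [|n IHn] nk.
      case: (stable 0) => // _ _; apply=> [l0 /YR|c Pic].
        by rewrite -[F 0]lits_at_canonical.
      have := closed_law_sat closedY occ nk Pic.
      by rewrite /= (lits_at_canonical (leq0n _)); case: (c).
    case: (stable n.+1 nk) => _ _; apply=> [l0 /YR|c Pic].
      by rewrite -[F n.+1]lits_at_canonical.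
    have := closed_law_sat closedY occ nk Pic.
    rewrite /= (IHn (ltnW nk)).
    by rewrite (lits_at_canonical nk) (lits_at_canonical (ltnW nk)).
  have holdsl n f : n <= k.+1 -> F n f -> Y (hlit Sigma n f).
    by move=> nk; rewrite -holds.
  have terms t : term_closure C t -> complete j s F Y t.
    move: t; apply: term_children_ind => t IHt ct.
    apply: (complete_step closedY jk occ next _ ct) => //.
    + by move=> n f nk; apply: (holdsl n (Pos f)).
    + exact: on_children_mp IHt (term_closure_children ct).
    + by apply: on_children_all => x n nk [].
  case: l => [[n|a|f|a n|f n|n n'|n|n|A q a q'|A q|t n]|
              [n|a|f|a n|f n|n n'|n|n|A q a q'|A q|t n]] //=.
  + by move=> nk; apply: (use _ (tr_state Pi nk)).
  + by move=> _; apply: (use _ (tr_is_action k Pi a)).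
  + by move=> _; apply: (use _ (tr_is_fluent k Pi f)).
  + by move=> [nk ->]; apply: occ.
  + by move=> [nk]; apply: (holdsl n (Pos f)).
  + by move=> [nk ->]; apply: next.
  + move=> [nk [f [[fp fn]|[fp fn]]]].
      apply: (use _ (tr_diff_pos Pi f nk)) => //=; split.
        by apply: (holdsl n (Pos f)) => //; apply: leqW.
      by split=> //; apply: (holdsl k.+1 (Neg f)).
    apply: (use _ (tr_diff_neg Pi f nk)) => //=; split.
      by apply: (holdsl k.+1 (Pos f)).
    by split=> //; apply: (holdsl n (Neg f)) => //; apply: leqW.
  + by move=> [nk nd]; apply: (use _ (tr_eq_last Pi nk)) => //=; split=> // -[].
  + move=> [step [x [y [u [q0 [Cu sub]]]]]].
    exact: (use' _ (tr_trans k Cu sub step)).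
  + move=> [fin [x [y [u [q0 [Cu sub]]]]]].
    exact: (use' _ (tr_final k Cu sub fin)).
  + move=> [nk [->|ct] tt]; last exact: (terms t ct).
    exact: (use' _ (tr_sat_true C nk)).
  + move=> [nk na]; apply: (use _ (tr_not_occurs Pi nk na)) => //=.
    by split=> //; apply: occ.
  + by move=> [nk]; apply: (holdsl n (Neg f)).
  + move=> [-> nk nj]; apply: (use _ (tr_not_next Pi nk (leqW jk) nj)) => //=.
- exact: canonical_closed.
- case=> [n|a|f|a n|f n|n n'|n|n|A q a q'|A q|t n] //= [] //.
  + by move=> [_ ->] [_].
  + by move=> [nk Fp] [_ Fn]; case: (stable n nk) => cons _ _; apply: (cons f).
  + by move=> [_ ->] [-> _]; rewrite /next_state ltnn.
Qed.

End Canonical.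

(** * Every answer set is canonical *)

Section AnswerSetShape.
Variable R : set (lit atom).
Hypothesis ansR : answer_set translation R.

Let cons : consistent R.
Proof. by case: ansR. Qed.

Let clo_laws r : tr_laws k Pi r -> all_prop (fun l => ~ R l) (rneg r) ->
  all_prop R (rpos r) -> head_sat R (rhead r).
Proof. by case: ansR => _ /closed_reductP clo _ /translation_laws /clo. Qed.

Let clo_terms r : tr_terms k C r -> all_prop (fun l => ~ R l) (rneg r) ->
  all_prop R (rpos r) -> head_sat R (rhead r).
Proof. by case: ansR => _ /closed_reductP clo _ /translation_terms /clo. Qed.

(* What the rules with a given head say about it, in terms of R alone. *)
Definition shape : set (lit atom) := fun l => match l with
  | Pos (IsState n) => n <= k.+1
  | Pos (Occurs _ n) => n <= k
  | Pos (DiffLast n) => n <= k /\ differs_from_last (lits_at R) n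
  | Pos (EqLast n) => n <= k /\ ~ R (Pos (DiffLast n))
  | Pos (Trans A q a q') => q' \in nfa_step q a /\
      exists x y u q0, C u /\ subterm (@TUntil _ _ A q0 x y) u
  | Pos (Final A q) => q \in nfa_final A /\
      exists x y u q0, C u /\ subterm (@TUntil _ _ A q0 x y) u
  | Pos (Sat t n) => n <= k.+1 /\ (t = TTrue \/ term_closure C t)
  | Pos (Holds _ n) | Neg (Holds _ n) => n <= k.+1
  | Pos (NextSt n n') => n < k /\ n' = n.+1 \/ n = k /\ n' <= k
  | Neg (Occurs a n) => n <= k /\ exists a', R (Pos (Occurs a' n))
  | Neg (NextSt n n') => [/\ n = k, n' <= k.+1 & exists n1, R (Pos (NextSt k n1))]
  | Neg _ => False
  | _ => True
  end.

Lemma answer_set_shape : R `<=` shape.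
Proof.
have hl n l0 : n <= k.+1 ->
    if omap (hlit Sigma n) l0 is Some l then shape l else True.
  by case: l0 => [[f|f]|].
apply: answer_set_sub ansR _ => r [[]|[]] //=.
- by move=> a a1 n nk _ _ [[Ra _] _]; split=> //; exists a1.
- by move=> a l0 pos neg n nk *; apply: hl.
- by move=> l0 pos neg n nk *; apply: hl.
- by move=> l0 pos neg n nk *; apply: hl.
- by move=> l0 pos neg *; apply: hl.
- by move=> f n nk _ [[Rp _] [[Rn _] _]]; split=> //; exists f; left.
- by move=> f n nk _ [[Rp _] [[Rn _] _]]; split=> //; exists f; right.
- by move=> n nk [].
- by left.
- by move=> n n' nk nk' _ _ [[Rn _] _]; split=> //; exists n'.
- by right.
- by move=> A q q1 x y u a q2 Cu sub *; split=> //; exists x, y, u, q.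
- by move=> A q q1 x y u Cu sub *; split=> //; exists x, y, u, q.
- by move=> n nk _ _; split=> //; left.
- by move=> f n nk ct _ _; split=> //; right.
- by move=> x y n nk ct _ _; split=> //; right.
- by move=> x y n nk ct _ _; split=> //; right.
- by move=> x n nk ct _ _; split=> //; right.
- by move=> A q x y n nk ct _ _; split=> //; right.
- by move=> A q q1 x y a n n1 nk n1k ct _ _ _; split=> //; right.
Qed.

Lemma occurs_uniq a a' n :
  R (Pos (Occurs a n)) -> R (Pos (Occurs a' n)) -> a = a'.
Proof.
move=> Ra Ra'; apply: contrapT => aa'; have /= nk := answer_set_shape Ra.
apply: (cons (p := Occurs a n)); split=> //.
by apply: (clo_laws (tr_not_occurs Pi nk aa')).
Qed.

Lemma next_uniq n n' : R (Pos (NextSt k n)) -> R (Pos (NextSt k n')) -> n = n'.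
Proof.
move=> Rn Rn'; apply: contrapT => nn'.
have le m : R (Pos (NextSt k m)) -> m <= k.+1.
  by move=> /answer_set_shape /= [[]|[_ /leqW //]]; rewrite ltnn.
apply: (cons (p := NextSt k n)); split=> //.
by apply: (clo_laws (tr_not_next Pi (le _ Rn) (le _ Rn') nn')).
Qed.

(** Either a0 is explicitly excluded, which only the occurrence of another action can cause, or the
    default rule for a0 fires. The loop point is found in the same way in [next_ex]. *)
Lemma occurs_ex (a0 : Sigma) n : n <= k -> exists a, R (Pos (Occurs a n)).
Proof.
move=> nk; have [/answer_set_shape /= [_ //]|nR] :=
  pselect (R (Neg (Occurs a0 n))).
by exists a0; apply: (clo_laws (tr_occurs Pi a0 nk)).
Qed.

Lemma next_ex : exists2 j, j <= k & R (Pos (NextSt k j)).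
Proof.
have [j Rj] : exists j, R (Pos (NextSt k j)).
  have [/answer_set_shape /= [_ _ //]|nR] := pselect (R (Neg (NextSt k 0))).
  by exists 0; apply: (clo_laws (tr_next Pi (leq0n k))).
by exists j => //; have /= [[]|[]] := answer_set_shape Rj; rewrite ?ltnn.
Qed.

Section Described.
Variables (j : nat) (s : nat -> Sigma) (F : nat -> set (lit Fl)).
Hypothesis R_occurs : forall n, n <= k -> R (Pos (Occurs (s n) n)).
Hypothesis R_next : R (Pos (NextSt k j)).
Hypothesis R_holds : forall n, n <= k.+1 -> lits_at R n = F n.

Let jk : j <= k.
Proof. by have /= [[]|[]] := answer_set_shape R_next; rewrite ?ltnn. Qed.

Let occursE n a : R (Pos (Occurs a n)) -> n <= k /\ a = s n.
Proof.
move=> Ra; have /= nk := answer_set_shape Ra; split=> //.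
exact: occurs_uniq Ra (R_occurs nk).
Qed.

Let nextE n n' : R (Pos (NextSt n n')) -> n <= k /\ n' = next_state k j n.
Proof.
move=> Rn; have /= := answer_set_shape Rn; rewrite /next_state.
case=> [[nk ->]|[nk n'k]]; first by rewrite nk ltnW.
by move: Rn; rewrite nk ltnn => Rn; split=> //; apply: next_uniq Rn R_next.
Qed.

Let R_succ n : n <= k -> R (Pos (NextSt n (next_state k j n))).
Proof.
rewrite /next_state; case: ltnP => [nk _|kn nk].
  exact: (clo_laws (tr_next_succ Pi nk)).
by have -> : n = k by apply/eqP; rewrite eqn_leq nk kn.
Qed.

Let holdsE n l : n <= k.+1 -> R (hlit Sigma n l) <-> F n l.
Proof. by move=> nk; rewrite -R_holds. Qed.

(** A smaller candidate X for state n would let R be cut down at n to a smaller closed set, against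
    rule induction. *)
Lemma described_stable : stable_states s F.
Proof.
move=> n nk.
have sat m c : m <= k.+1 -> Pi c ->
    law_sat (arrival s m) (lits_at R m.-1) (lits_at R m)
      (lits_at R m.-1) (lits_at R m) c.
  by case: ansR => _ closR _; apply: closed_law_sat.
have predk m : m <= k.+1 -> m.-1 <= k.+1 by case: m => // m /ltnW.
split.
- by rewrite -R_holds // => f [fp fn]; apply: (cons (p := Holds f n)).
- by move=> c Pic; rewrite -!R_holds ?predk //; apply: sat.
move=> X XF Xsat; apply/seteqP; split=> //.
pose Z : set (lit atom) := fun l => match l with
  | Pos (Holds f m) => m = n -> X (Pos f)
  | Neg (Holds f m) => m = n -> X (Neg f)
  | _ => True
  end.
have Zhlit m l : Z (hlit Sigma m l) <-> (m = n -> X l) by case: l.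
suff RZ : R `<=` Z by move=> l /(holdsE _ nk) /RZ /Zhlit; apply.
pose Y := R `&` Z.
have Yn : lits_at Y n = X.
  apply/seteqP; split=> l; first by move=> [_ /Zhlit]; apply.
  by move=> Xl; split; [apply/holdsE => //; apply: XF|apply/Zhlit].
have Ym m : m != n -> lits_at Y m = lits_at R m.
  move=> mn; apply/seteqP; split=> l; first by case.
  by move=> Rl; split=> //; apply/Zhlit => e; rewrite e eqxx in mn.
have YR m : lits_at Y m `<=` lits_at R m by move=> l [].
apply: answer_set_sub ansR _ => r [Pr|Tr] neg pos; last first.
  by case: Tr {neg pos}.
suff : head_sat Y (rhead r) by case: (rhead r) => // l [].
apply: (tr_laws_sat (Y := Y) (X := R) (s := s)) Pr neg pos.
- by move=> a m _ [/occursE[]].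
(* State n+1 now sees a smaller predecessor, which [law_sat_weaken] allows; only at n itself is the
   assumption on X used. *)
- move=> m c mk Pic; apply: law_sat_weaken (YR m.-1) _.
  have [->|mn] := eqVneq m n; last by rewrite Ym //; apply: sat.
  by rewrite Yn !R_holds ?predk //; apply: Xsat.
(* The heads of these rules are never [Holds] literals, so Z imposes nothing on them and closure of
   R suffices. *)
- move=> r0 Pr0 neg pos.
  have : head_sat R (rhead r0).
    have Pr : tr_laws k Pi r0 by case: Pr0 => //; constructor.
    by apply: clo_laws Pr neg _; apply: all_prop_sub pos => l [].
  have : ((if rhead r0 is Some l then Z l else True) : Prop) by case: Pr0.
  by case: (rhead r0).
Qed.

(** Both halves go through one induction, as negation exchanges them. *)
Lemma described_terms t : term_closure C t -> sound j s F R t /\ complete j s F R t.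
Proof.
move: t; apply: term_children_ind => t IHt ct.
have clR : closed_under (reduct translation R) R by case: ansR.
have ch := on_children_mp IHt (term_closure_children ct).
have snd : on_children (sound j s F R) t by case: (t) ch => //= *; intuition.
have comp : on_children (complete j s F R) t by case: (t) ch => //= *; intuition.
split.
  apply: (sound_step ansR _ _ _ snd comp) => //.
  - by move=> n n' _ /nextE[].
  - by move=> n f nk /(holdsE (Pos f) nk).
apply: (complete_step clR jk _ _ _ ct) => // n f nk Ff.
exact/(holdsE (Pos f) nk).
Qed.

Let differsE n :
  n <= k -> differs_from_last (lits_at R) n <-> differs_from_last F n.
Proof. by move=> nk; rewrite /differs_from_last !R_holds // leqW. Qed.

Let diff_last n : n <= k -> differs_from_last F n -> R (Pos (DiffLast n)).
Proof.
move=> nk /(differsE nk)[f [[fp fn]|[fp fn]]].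
  by apply: (clo_laws (tr_diff_pos Pi f nk)).
by apply: (clo_laws (tr_diff_neg Pi f nk)).
Qed.

(** A difference puts [DiffLast j] in R, which leaves [EqLast j] unsupported and violates the loop
    constraint. *)
Lemma described_same : ~ differs_from_last F j.
Proof.
move=> /(diff_last jk) dj.
have [eqR|ne] := pselect (R (Pos (EqLast j))).
  by have [_] := answer_set_shape eqR.
by apply: (clo_laws (tr_loop Pi jk)).
Qed.

Lemma described_sat u : C u -> term_holds k j s F u 0.
Proof.
move=> Cu; have cu : term_closure C u.
  by apply: term_closure_sub Cu _; apply: subterm_refl.
have [snd _] := described_terms cu; apply: snd => //.
by apply: contrapT => nsat; apply: (clo_terms (tr_constraint k Cu)).
Qed.

Lemma described_canonical : R = canonical j s F.
Proof.
have canon := canonical_answer_set jk described_stable described_same described_sat.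
apply: answer_set_antichain ansR canon _ => l Rl.
have shl := answer_set_shape Rl; move: l Rl shl.
case=> [[n|a|f|a n|f n|n n'|n|n|A q a q'|A q|t n]|
        [n|a|f|a n|f n|n n'|n|n|A q a q'|A q|t n]] //=.
- by move=> /occursE.
- by move=> Rl nk; split=> //; apply/(holdsE (Pos f)).
- by move=> /nextE.
- by move=> _ [nk /(differsE nk)].
- by move=> _ [nk nd]; split=> // /(diff_last nk).
- move=> Rl [nk [->|ct]]; split=> //; [by left|by right|].
  by have [snd _] := described_terms ct; apply: snd.
- move=> Rn [nk _]; split=> // ea; rewrite ea in Rn.
  by apply: (cons (p := Occurs (s n) n)); split=> //; apply: R_occurs.
- by move=> Rl nk; split=> //; apply/(holdsE (Neg f)).
- move=> Rn [nk n'k _]; split=> // nj; rewrite nk nj in Rn.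
  by apply: (cons (p := NextSt k j)).
Qed.

End Described.
End AnswerSetShape.

End Translated.

(** * Unfolding the loop *)

Section Loops.
Variables (k j : nat).
Hypothesis jk : j <= k.
Local Notation loop := (loop_state k j).

Lemma loop_state_id i : i <= k -> loop i = i.
Proof. by rewrite /loop_state => ->. Qed.

Lemma loop_state_le i : loop i <= k.
Proof.
rewrite /loop_state; case: ifP => // _.
have := ltn_pmod (i - j) (d := k.+1 - j).
by rewrite subn_gt0 ltnS => /(_ jk); lia.
Qed.

Lemma loop_stateS i : loop i.+1 = next_state k j (loop i).
Proof.
rewrite /next_state; have [ik|ki] := ltnP i k.
  by rewrite !loop_state_id ?ik // ltnW.
rewrite {1}/loop_state ltnNge ki /=.
have d0 : 0 < k.+1 - j by rewrite subn_gt0 ltnS.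
have -> : i.+1 - j = (i - j).+1 by rewrite subSn // (leq_trans jk).
have [ei|ik] := eqVneq i k.
  by rewrite ei loop_state_id // ltnn -subSn // modnn addn0.
have -> : loop i = j + (i - j) %% (k.+1 - j).
  by rewrite /loop_state ifF //; lia.
rewrite -addn1 -modnDml addn1; set r := (i - j) %% _.
have rd : r < k.+1 - j by apply: ltn_pmod.
(* Either the residue r grows by one inside the loop, or r is the last residue and wraps around to
   j. *)
have [lt|ge] := ltnP (j + r) k; first by rewrite modn_small; lia.
have -> : r.+1 = k.+1 - j by lia.
by rewrite modnn addn0.
Qed.

Lemma loop_state_idem i : loop (loop i) = loop i.
Proof. exact/loop_state_id/loop_state_le. Qed.

Lemma loop_state_last : loop k.+1 = j.
Proof. by rewrite loop_stateS loop_state_id // /next_state ltnn. Qed.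

(** A derivation in the least fixpoint is an accepting run on a finite segment of the unfolded word,
    whose length m counts the uses of the step rule. *)
Lemma until_holdsP (Sigma : Type) (s : nat -> Sigma) (A : nfa Sigma)
    (P Q : nat -> Prop) (q : nfa_state A) i :
  (forall i, s (loop i) = s i) ->
  until_holds k j s P Q q (loop i) <->
  exists m, [/\ nfa_accept q (map s (iota i m)), Q (loop (i + m)) &
                forall m', m' < m -> P (loop (i + m'))].
Proof.
move=> s_loop; split.
  move en : (loop i) => n until.
  elim: until i en => {q n} [q n fin Qn|q q1 n nk Pn step _ IH] i en.
    by exists 0; rewrite addn0 en.
  have /IH[m [acc Qm Pm]] : loop i.+1 = next_state k j n by rewrite loop_stateS en.
  exists m.+1; split=> /=.
  - by apply/existsP; exists q1; rewrite acc andbT -s_loop en.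
  - by rewrite addnS -addSn.
  - by case=> [|m' /Pm]; rewrite ?addn0 ?en // addnS -addSn.
case=> m; elim: m q i => [|m IHm] q i /= [acc Qm Pm].
  by apply: until_final => //; rewrite addn0 in Qm.
have /existsP[q1 /andP[step acc1]] := acc.
apply: (@until_step _ _ _ _ _ _ _ _ q1); first exact: loop_state_le.
- by have := Pm 0 isT; rewrite addn0.
- by rewrite s_loop.
rewrite -loop_stateS; apply: IHm; split=> //; first by rewrite addSn -addnS.
by move=> m' lt; rewrite addSn -addnS; apply: Pm.
Qed.

End Loops.

(** * DLTL formulas on the unfolded loop *)

Section Formulas.
Variables (Sigma : finType) (Fl : Type).
Variables (aut : prog Sigma -> nfa Sigma) (ini : forall pi, nfa_state (aut pi)).
Hypothesis aut_lang : forall pi w, nfa_accept (ini pi) w <-> prog_lang pi w.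

(** With [proper_prefix_iota], this turns the word quantifiers of the until semantics into
    quantifiers over lengths. *)
Lemma is_prefix_cat (s : nat -> Sigma) i tau :
  is_prefix s (pref s i ++ tau) <-> exists m, tau = map s (iota i m).
Proof.
split=> [[n e]|[m ->]]; last by exists (i + m); rewrite pref_addn.
exists (n - i); have le : i <= n.
  by have := congr1 size e; rewrite size_cat !size_pref => <-; apply: leq_addr.
move: e; rewrite -{1}(subnKC le) pref_addn => /eqP.
by rewrite eqseq_cat // eqxx => /eqP.
Qed.

Lemma proper_prefix_iota (s : nat -> Sigma) i m tau :
  prefix tau (map s (iota i m)) /\ tau != map s (iota i m) <->
  exists2 m', m' < m & tau = map s (iota i m').
Proof.
split=> [[]|[m' lt ->]].
  rewrite prefixE -map_take take_iota => /eqP e ne.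
  exists (minn (size tau) m); rewrite ?e // ltn_neqAle geq_minr andbT.
  by apply: contra ne => /eqP em; rewrite -e em.
split.
  by rewrite prefixE -map_take take_iota size_map size_iota (minn_idPl (ltnW lt)).
by apply/eqP => /(congr1 size); rewrite !size_map !size_iota; lia.
Qed.

(** Agreement of F with the valuation up to k suffices, since [loop_state] never reaches k+1. *)
Lemma holds_at_term (M : tmodel Sigma Fl) k j (F : nat -> set (lit Fl)) phi i :
  kloop k j M ->
  (forall n p, n <= k -> F n (Pos p) <-> valu M (pref (mword M) n) p) ->
  holds_at M (pref (mword M) i) phi <->
  term_holds k j (mword M) F (term_of ini phi) (loop_state k j i).
Proof.
move=> [jk loop] FV.
elim: phi i => [||p|a IHa|a IHa b IHb|pi a IHa b IHb] i //=.
- by rewrite (loop i).2; apply: iff_sym; apply: FV; apply: loop_state_le.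
- by split=> na /IHa.
- by split=> -[/IHa|/IHb]; by [left|right].
rewrite (until_holdsP jk); last by move=> n; rewrite -(loop n).1.
split.
  case=> tau [/aut_lang acc /is_prefix_cat[m etau]]; rewrite {}etau in acc *.
  rewrite -pref_addn => /IHb Qm Pm; exists m; split=> // m' lt.
  apply/IHa; rewrite pref_addn.
  have [|pre ne] := (proper_prefix_iota (mword M) i m (map (mword M) (iota i m'))).2.
    by exists m'.
  exact: Pm.
case=> m [acc /IHb Qm Pm]; exists (map (mword M) (iota i m)); split.
- exact/aut_lang.
- by apply/is_prefix_cat; exists m.
- by rewrite -pref_addn.
move=> tau pre ne.
have [|m' lt ->] := (proper_prefix_iota (mword M) i m tau).1; first by [].
by rewrite -pref_addn; apply/IHa; apply: Pm.
Qed.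

End Formulas.

(** In a total consistent state the negative literals are the complement of the positive ones. So
    periodicity of the temporal model, which records only positive literals, extends to whole
    states. *)
Lemma total_interp_ext (Sigma Fl : Type) (s : nat -> Sigma)
    (S S' : set (seq Sigma * lit Fl)) n n' :
  partial_interp (TInterp s S) -> partial_interp (TInterp s S') ->
  total_interp (TInterp s S) -> total_interp (TInterp s S') ->
  (forall p, S (pref s n, Pos p) <-> S' (pref s n', Pos p)) ->
  state_at s S n = state_at s S' n'.
Proof.
move=> [_ cons] [_ cons'] total total' pos; apply/seteqP.
split=> -[p|p]; rewrite /state_at /= ?pos // => neg.
  have [p'|//] := total' _ (is_prefix_pref s n') p.
  by case: (cons (pref s n) p); split=> //; apply/pos.
have [p'|//] := total _ (is_prefix_pref s n) p.
by case: (cons' (pref s n') p); split=> //; apply/pos.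
Qed.

(** * Extensions with a loop point against answer sets *)

Section Correspondence.
Variables (Sigma : finType) (Fl : Type) (D : domain Sigma Fl).
Variables (aut : prog Sigma -> nfa Sigma) (ini : forall pi, nfa_state (aut pi)).
Hypothesis aut_lang : forall pi w, nfa_accept (ini pi) w <-> prog_lang pi w.
Variable (k : nat).
Let C : set (term Sigma Fl) := term_of ini @` constraints D.

(** The loop point accompanies the extension because one model may be a k-loop for several j, each
    giving its own answer set. *)
Definition answer_set_of (Ej : tinterp Sigma Fl * nat) :
    set (lit (atom Sigma Fl)) :=
  canonical k C Ej.2 (tword Ej.1) (state_at (tword Ej.1) (tlits Ej.1)).

Lemma loop_states s S j :
  extension D (TInterp s S) -> kloop k j (model_of (TInterp s S)) ->
  forall n, state_at s S n = state_at s S (loop_state k j n).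
Proof.
move=> [[[part _] _] total _] [jk loop] n.
apply: (total_interp_ext part part total total) => p.
by have /= [_] := loop n; move=> /(congr1 (fun V => V p)) /= ->.
Qed.

Lemma answer_set_of_extension E j :
  extension D E -> kloop k j (model_of E) ->
  answer_set (tr_domain ini k D) (answer_set_of (E, j)).
Proof.
case: E => s S extE loopE; have states := loop_states extE loopE.
have [jk _] := loopE; have [TAS _ sat] := extE.
have [_ stable] := (temporal_answer_setP (laws D) s S).1 TAS.
apply: canonical_answer_set => //.
  (* State k+1 equals state j, so a difference would make state j inconsistent. *)
  rewrite /differs_from_last (states k.+1) (loop_state_last jk).
  case=> f [] [fp fn]; case: (stable j) => cons _ _; exact: (cons f).
move=> _ [phi Cphi <-].
apply/(holds_at_term aut_lang (M := model_of (TInterp s S)) _ 0 loopE) => //.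
exact: sat.
Qed.

Lemma answer_set_of_genuine E j :
  extension D E -> kloop k j (model_of E) -> genuine_loop k (answer_set_of (E, j)).
Proof.
case: E => s S extE loopE j' [_ ->] l; have [jk _] := loopE.
rewrite /next_state ltnn.
have hl n : n <= k.+1 ->
    answer_set_of (TInterp s S, j) (hlit Sigma n l) <-> state_at s S n l.
  by move=> nk; rewrite -(@lits_at_canonical _ _ k C j s (state_at s S) n).
rewrite !hl // ?(leqW jk) // (loop_states extE loopE k.+1) loop_state_last //.
Qed.

Lemma is_model_of_answer_set_of E j :
  extension D E -> kloop k j (model_of E) ->
  is_model_of k j (answer_set_of (E, j)) (model_of E).
Proof.
case: E => s S extE loopE; have [jk loop] := loopE.
have lk := loop_state_le jk; split=> //; first by rewrite /= /next_state ltnn.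
move=> i; split=> [|p] /=; first by have [] := loop i.
have -> : S (pref s i, Pos p) = state_at s S i (Pos p) by [].
by rewrite (loop_states extE loopE i); split=> [|[]] //; split=> //; apply: leqW.
Qed.

(** The loop point, the actions and the states up to k can be read off the answer set; periodicity
    then fixes all positions, and literals live only on prefixes of the word. *)
Lemma answer_set_of_inj E E' j j' :
  extension D E -> kloop k j (model_of E) ->
  extension D E' -> kloop k j' (model_of E') ->
  answer_set_of (E, j) = answer_set_of (E', j') -> (E, j) = (E', j').
Proof.
case: E E' => [s S] [s' S'] extE loopE extE' loopE' eqR.
have mem l :
    answer_set_of (TInterp s S, j) l <-> answer_set_of (TInterp s' S', j') l.
  by rewrite eqR.
have ej : j = j'.
  have [_] : answer_set_of (TInterp s' S', j') (Pos (NextSt k j)).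
    by apply/mem; rewrite /= /next_state ltnn.
  by rewrite /= /next_state ltnn.
rewrite -{j'}ej in loopE' mem eqR *.
have [jk loop] := loopE; have [_ loop'] := loopE'.
have lk := loop_state_le jk.
have es : s = s'.
  apply/funext => n; have /= [-> _] := loop n; have /= [-> _] := loop' n.
  have : answer_set_of (TInterp s S, j)
    (Pos (Occurs (s (loop_state k j n)) (loop_state k j n))) by [].
  by move=> /mem [].
rewrite -{s'}es in extE' loopE' loop' mem eqR *.
have eF n : state_at s S n = state_at s S' n.
  rewrite (loop_states extE loopE) (loop_states extE' loopE').
  have lk1 := leqW (lk n).
  by rewrite -(lits_at_canonical C j s _ lk1) -[RHS](lits_at_canonical C j s _ lk1)
     /lits_at -/(answer_set_of (TInterp s S, j)) eqR.
have [[[[supp _] _] _] _ _] := extE; have [[[[supp' _] _] _] _ _] := extE'.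
suff -> : S = S' by [].
apply/seteqP; split=> -[tau l] Sl.
  have [n etau] := supp _ _ Sl; rewrite etau in Sl *.
  have : state_at s S n l by [].
  by rewrite eF.
have [n etau] := supp' _ _ Sl; rewrite etau in Sl *.
have : state_at s S' n l by [].
by rewrite -eF.
Qed.

Lemma answer_set_of_surj (a0 : Sigma) R :
  well_defined D -> answer_set (tr_domain ini k D) R -> genuine_loop k R ->
  exists E j, [/\ extension D E, kloop k j (model_of E) & R = answer_set_of (E, j)].
Proof.
move=> wd ansR genuine.
have {}ansR : answer_set (translation k (laws D) C) R by [].
have [j jk Rj] := next_ex ansR.
(* Beyond k any action will do, as s below consults [act] only at states up to k. *)
have /choice[act Ract] n : exists a, n <= k -> R (Pos (Occurs a n)).
  have [nk|_] := boolP (n <= k); last by exists a0.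
  by have [a Ra] := occurs_ex ansR a0 nk; exists a.
pose s n := act (loop_state k j n).
pose F n := lits_at R (loop_state k j n).
pose S := [set x | exists2 n, x.1 = pref s n & F n x.2].
have lk := loop_state_le jk.
have eF n : state_at s S n = F n.
  apply/seteqP; split=> l /=; last by move=> Fnl; exists n.
  by case=> n' /= /pref_inj ->.
have Rs n : n <= k -> R (Pos (Occurs (s n) n)).
  by move=> nk; rewrite /s loop_state_id //; apply: Ract.
(* At k+1 the unfolding shows state j, and [genuine_loop] identifies the two. *)
have RF n : n <= k.+1 -> lits_at R n = state_at s S n.
  rewrite eF /F leq_eqVlt ltnS => /orP[/eqP ->|nk]; last by rewrite loop_state_id.
  rewrite loop_state_last //; apply/seteqP; split=> l; by move=> /(genuine _ Rj).
(* The transition into position n+1 is justified by the one from [loop_state k j n] to its numerical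
   successor. When the loop closes, this is stability of state k+1, not of state j. *)
have stable : forall n,
    stable_state (laws D) (arrival s n) (state_at s S n.-1) (state_at s S n).
  have stk := described_stable ansR Rs RF.
  case=> [|n]; first exact: (stk 0).
  have := stk (loop_state k j n).+1 (lk n); rewrite /= !eF /F /s.
  by rewrite !loop_stateS // !loop_state_idem.
have TAS : temporal_answer_set (laws D) (TInterp s S).
  apply/temporal_answer_setP; split=> // tau l [n /= -> _]; exact: is_prefix_pref.
have loopE : kloop k j (model_of (TInterp s S)).
  split=> // i; split; first by rewrite /= /s loop_state_idem.
  have valuE n : valu (model_of (TInterp s S)) (pref s n) = [set p | F n (Pos p)].
    by rewrite -eF.
  by rewrite !valuE /F loop_state_idem.
exists (TInterp s S), j; split=> //.
  (* Totality comes from well-definedness of the domain description. *)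
  split=> //; first exact: wd.
  move=> phi Cphi; pose M := model_of (TInterp s S).
  apply/(holds_at_term aut_lang (M := M) (F := state_at s S) _ 0 loopE) => //=.
  by apply: (described_sat ansR Rs Rj RF); exists phi.
exact: (described_canonical ansR Rs Rj RF).
Qed.

End Correspondence.

Theorem corollary1 (Sigma : finType) (Sigma_nonempty : (0 < #|Sigma|)%N)
    (Fl : Type) (D : domain Sigma Fl)
    (D_initial : default_initial_laws (laws D))
    (D_wd : well_defined D)
    (aut : prog Sigma -> nfa Sigma) (ini : forall pi, nfa_state (aut pi))
    (aut_lang : forall pi w, nfa_accept (ini pi) w <-> prog_lang pi w)
    (k : nat) :
  exists corr : tinterp Sigma Fl * nat -> set (lit (atom Sigma Fl)),
    set_bij
      [set Ej | extension D Ej.1 /\ kloop k Ej.2 (model_of Ej.1)]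
      [set R | answer_set (tr_domain ini k D) R /\ genuine_loop k R]
      corr /\
    (forall E j, extension D E -> kloop k j (model_of E) ->
       is_model_of k j (corr (E, j)) (model_of E)).
Proof.
exists (answer_set_of D ini k); split; last first.
  by move=> E j extE loopE; apply: is_model_of_answer_set_of.
have [a0 _] := card_gt0P Sigma_nonempty.
split.
- move=> [E j] [/= extE loopE]; split.
    exact: answer_set_of_extension.
  exact: answer_set_of_genuine.
- move=> [E j] [E' j'] /set_mem [/= extE loopE] /set_mem [/= extE' loopE'].
  exact: answer_set_of_inj.
- move=> R [ansR genuine].
  have [E [j [extE loopE ->]]] := answer_set_of_surj aut_lang a0 D_wd ansR genuine.
  by exists (E, j).
Qed.
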